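(* Let $V=\mathbb{R}^2(x,y)$ with symplectic form $\omega=dx\wedge dy$, and let the affine symplectic group $H=\mathrm{ASp}(2,\mathbb{R})=\mathrm{Sp}(2,\mathbb{R})\ltimes\mathbb{R}^2$ act on $V$ by affine transformations. For curves $y=y(x)$ put $$I'_4=\sqrt[3]{y_2}\,(3y_2^{-2}y_4-5y_2^{-3}y_3^2),\quad \nabla'=\frac1{\sqrt[3]{y_2}}\mathcal{D}_x,\quad I''_4=(I'_4)^3,\quad \nabla''=I'_4\nabla' .$$ Then the algebra of differential invariants of the $H$-action on the space $J^\infty(V,1)$ of infinite jets of curves in $V$ is freely generated as $\mathcal{A}_H=\langle I''_4\,;\,\nabla''\rangle$.
   Context: $J^k(V,1)$ is the space of $k$-jets of unparametrized curves in $V$, with coordinates $x,y,y_1,\dots,y_k$ on the chart of graphs $y=y(x)$, where $y_l$ is the $l$-th derivative; $\mathcal{D}_x$ is the total derivative. $H$ acts on $J^k(V,1)$ by prolongation. A differential invariant of order $k$ is a function on $J^k(V,1)$ constant on orbits of the prolonged action; differential invariants are taken to be rational functions of the jet-variables (and may be chosen polynomial in jet-variables of sufficiently high order). $\mathcal{A}_H$ is the algebra of all differential invariants. An invariant derivation is a derivation $f\mathcal{D}_x$, $f$ a function on a finite jet space, commuting with the prolonged action. 'Freely generated as $\langle I;\nabla\rangle$' means: every element of the algebra is a rational expression in finitely many of the functions $\nabla^jI$, $j\ge0$, and these functions are algebraically independent (no differential syzygies). *)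

(* Defs.v *)
From HB Require Import structures.
From mathcomp Require Import all_boot all_order all_algebra.
From mathcomp Require Import reals topology normedtype derive exp.
From mathcomp Require mpoly.
(* The notations of mpoly clash with those of analysis; only its constants and
   canonical structures are imported. *)
Import -(notations) mpoly.

Set Implicit Arguments.
Unset Strict Implicit.
Unset Printing Implicit Defensive.

Import Order.TTheory GRing.Theory Num.Theory.
Import numFieldNormedType.Exports.

Local Open Scope ring_scope.

(** * The affine symplectic group *)

Section Group.
Context {R : realType}.

(* omega = dx /\ dy *)
Definition omega (u v : 'cV[R]_2) : R := u 0 0 * v 1 0 - u 1 0 * v 0 0.

Definition symplectic (A : 'M[R]_2) : Prop :=
  forall u v : 'cV[R]_2, omega (A *m u) (A *m v) = omega u v.

(* The pair h stands for the affine map v |-> h.1 *m v + h.2. *)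
Definition ASp (h : 'M[R]_2 * 'cV[R]_2) : Prop := symplectic h.1.

End Group.

(** * Jets of curves and their prolonged transformations *)

(* A point of the chart of J^oo(V,1) formed by the jets of graphs y = y(x):
   [jx z] is x and [jy z l] is y_l.  A point of J^k(V,1) is given by x and the
   y_l with l <= k, so the J^k-notions below only look at those. *)
Record jet (R : Type) := Jet { jx : R ; jy : nat -> R }.

Section Jets.
Context {R : realType}.
Implicit Types (z w : jet R) (F G : jet R -> R) (h : 'M[R]_2 * 'cV[R]_2).

(* The k-jet z is the k-jet at x of the graph of this polynomial. *)
Definition taylor (k : nat) z : {poly R} :=
  \sum_(l < k.+1) (jy z l / l`!%:R) *: ('X - (jx z)%:P) ^+ l.

(* The image under h of the curve t |-> (t, u t). *)
Definition moved_graph h (u : {poly R}) : 'cV[{poly R}]_2 :=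
  map_mx (@polyC R) h.1 *m (\col_(i < 2) if i == 0 then 'X else u)
  + map_mx (@polyC R) h.2.

(* [prolongs k h z z'] : in J^k(V,1), h maps the jet of a curve at a point to
   the jet of the image curve at the image point.  With t |-> (X t, Y t) the
   image of the graph of [taylor k z] and v := [taylor k z'], the graph of v has
   contact of order k with the image curve at t = x, i.e. v (X t) - Y t vanishes
   to order k + 1 there.  For k >= 1 and h.1 invertible this forces X' x != 0,
   i.e. that the image jet lies in the chart of graphs. *)
Definition prolongs (k : nat) h z z' : Prop :=
  let c := moved_graph h (taylor k z) in
  jx z' = (c 0 0).[jx z] /\
  ('X - (jx z)%:P) ^+ k.+1 %| (taylor k z' \Po c 0 0) - c 1 0.

Definition prolongs_inf h z z' : Prop := forall k, prolongs k h z z'.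

(* The total derivative D_x = d/dx + sum_l y_(l+1) d/dy_l, as the directional
   derivative along the vector field it denotes. *)
Definition Dx F : jet R -> R := fun z =>
  derive1 (fun t : R => F (Jet (jx z + t) (fun l => jy z l + t * jy z l.+1))) 0.

(** * Rational functions and differential invariants *)

(* Polynomials in the k + 2 jet variables x, y, y_1, ..., y_k. *)
Definition jet_var (k : nat) z (i : 'I_k.+2) : R :=
  if val i is l.+1 then jy z l else jx z.

Definition jet_pol (k : nat) (p : mpoly k.+2 R) z : R :=
  meval (jet_var z) p.

Definition jet_rat (k : nat) (p q : mpoly k.+2 R) z : R :=
  jet_pol p z / jet_pol q z.

(* Functions on jets are only meaningful on a dense open set, where the
   denominators do not vanish; two of them are identified when they agree off
   the zero set of some nonzero polynomial in finitely many jet variables. *)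
Definition geneq F G : Prop :=
  exists (k : nat) (s : mpoly k.+2 R),
    s != 0 /\ forall z, jet_pol s z != 0 -> F z = G z.

(* The fraction p / q need not be reduced.  Since the domain q != 0 is dense
   and open, constancy on the orbits there does not depend on its choice. *)
Definition diff_invariant (k : nat) F : Prop :=
  exists p q : mpoly k.+2 R,
    [/\ q != 0,
        forall z, jet_pol q z != 0 -> F z = jet_rat p q z &
        forall h z z', ASp h -> prolongs k h z z' ->
          jet_pol q z != 0 -> jet_pol q z' != 0 -> F z' = F z].

Definition A_H F : Prop := exists k : nat, diff_invariant k F.

(* G is F \o h, where h acts by prolongation. *)
Definition pullback h F G : Prop :=
  forall z z', prolongs_inf h z z' -> G z = F z'.

(* nabla = f D_x with f a function on J^k(V,1), and nabla (F \o h) =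
   (nabla F) \o h for rational F, at the points where F is defined and off the
   zero set of a polynomial s at which f may be singular. *)
Definition invariant_derivation (nabla : (jet R -> R) -> (jet R -> R)) : Prop :=
  exists (f : jet R -> R) (k : nat) (s : mpoly k.+2 R),
    [/\ s != 0,
        forall z w, jx z = jx w -> (forall l, (l <= k)%N -> jy z l = jy w l) ->
          f z = f w,
        forall F z, nabla F z = f z * Dx F z &
        forall h (m : nat) (p q : mpoly m.+2 R) G, ASp h ->
          pullback h (jet_rat p q) G ->
          forall z z', prolongs_inf h z z' ->
          jet_pol s z != 0 -> jet_pol s z' != 0 -> jet_pol q z' != 0 ->
          nabla G z = nabla (jet_rat p q) z'].

(* P (I, nabla I, ..., nabla^(n-1) I) *)
Definition eval_orbit I (nabla : (jet R -> R) -> (jet R -> R)) (n : nat)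
    (P : mpoly n R) : jet R -> R :=
  fun z => meval (fun j : 'I_n => iter j nabla I z) P.

Definition freely_generated (A : (jet R -> R) -> Prop) I
    (nabla : (jet R -> R) -> (jet R -> R)) : Prop :=
  (forall F, A F <->
     exists (n : nat) (P Q : mpoly n R),
       ~ geneq (eval_orbit I nabla Q) (fun=> 0) /\
       geneq F (fun z => eval_orbit I nabla P z / eval_orbit I nabla Q z)) /\
  (forall (n : nat) (P : mpoly n R),
     geneq (eval_orbit I nabla P) (fun=> 0) -> P = 0).

(** * The generators *)

(* The real cube root, odd in a. *)
Definition cbrt (a : R) : R := Num.sg a * `|a| `^ (3%:R^-1).

Definition I4' z : R :=
  cbrt (jy z 2) *
  (3%:R * jy z 2 ^- 2 * jy z 4 - 5%:R * jy z 2 ^- 3 * jy z 3 ^+ 2).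

Definition nabla' F : jet R -> R := fun z => (cbrt (jy z 2))^-1 * Dx F z.

Definition I4'' z : R := I4' z ^+ 3.

Definition nabla'' F : jet R -> R := fun z => I4' z * nabla' F z.

End Jets.

(* Main.v *)
(** The field [nabla'' = N / y_2^3 D_x], with [N = 3 y_2 y_4 - 5 y_3^2], is invariant
    because a map of slope [m = a + b y_1] satisfies [h^* D_x = m^-1 D_x],
    [h^* y_2 = m^-3 y_2] and [h^* N = m^-8 N].  Every jet with [y_2 N <> 0] is moved by
    exactly one element of the group to the cross-section
    [x = y = y_1 = y_3 = 0, 3 y_4 = y_2^2], on which [I''_4 = y_2] and
    [nabla''^j I''_4 = 9 y_(j+4) / y_2 + (a Laurent expression in the jets of lower order)]
    for [j >= 1].  This triangular system identifies the cross-section with the space of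
    values of the [nabla''^j I''_4], which gives both the algebraic independence and,
    by evaluating an invariant on a translate of the cross-section that is not contained
    in the zero set of its denominator, the generation. *)

Require Import Defs.
From mathcomp Require Import all_boot all_order all_algebra.
From mathcomp Require Import boolp classical_sets functions reals topology normedtype derive exp.
From mathcomp Require mpoly.
From mathcomp Require Import ring lra zify.
Import -(notations) mpoly.

Set Implicit Arguments.
Unset Strict Implicit.
Unset Printing Implicit Defensive.

Import Order.TTheory GRing.Theory Num.Theory.
Import numFieldNormedType.Exports.

Local Open Scope ring_scope.

(** [Dx] is a limit taken along a line of infinite jets, so it can be handled only on a class of
    functions that it preserves and that obeys a chain rule. That class is [laurent]: polynomials in
    finitely many coordinates and in the inverse of one fixed function [d]. It is used with [d]
    equal to [slope h] for the prolonged action, to [y_2] for the iterates of [nabla''], in which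
    the cube roots have cancelled, and to the denominator of a rational function for the invariance
    of [nabla'']. The action itself is given by contact of curves and has to be identified with the
    recursion that divides by [slope h]. Translates of the cross-section are used because a
    denominator, for instance that of an unreduced fraction, may have [x] as a factor and then
    vanishes on the whole cross-section. *)

(** * Polynomials are determined by their values *)

Lemma poly_zero_fun (R : realType) (p : {poly R}) :
  (forall x, p.[x] = 0) -> p = 0.
Proof.
move=> p0; apply: (@roots_geq_poly_eq0 _ p (map (fun i => i%:R) (iota 0 (size p).+1))).
- by apply/allP => x _; apply/rootP.
- by rewrite map_inj_uniq ?iota_uniq // => i j /eqP; rewrite eqr_nat => /eqP.
- by rewrite size_map size_iota.
Qed.

(** Grouped by the exponent [e] of the last variable, [p] becomes univariate with the values of
    [r e] as coefficients. These vanish by the univariate case, and induction gives [r e = 0]. *)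
Lemma meval_eq0 (R : realType) n (p : mpoly n R) :
  (forall v, meval v p = 0) -> p = 0.
Proof.
elim: n p => [|n IH] p p0.
  apply/mpolyP => m; rewrite mcoeff0.
  have := p0 (fun=> 0); rewrite mevalE.
  under eq_bigr do rewrite big_ord0 mulr1.
  move=> s0.
  have [mp|/memN_msupp_eq0 //] := boolP (m \in msupp p).
  rewrite -s0 (bigD1_seq m) //= ?msupp_uniq // big1 ?addr0 // => m' /eqP [].
  by apply/mnmP => -[].
pose rest (m : multinom n.+1) : multinom n := Multinom [tuple m (widen_ord (leqnSn n) i) : nat | i < n].
pose r e : mpoly n R := \sum_(m <- msupp p | m ord_max == e) mcoeff m p *: mpolyX R (rest m).
have r0 e : r e = 0.
  apply: IH => v.
  pose q : {poly R} := \sum_(m <- msupp p) (mcoeff m p * \prod_(i < n) v i ^+ rest m i) *: 'X^(m ord_max).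
  have q0 : q = 0.
    apply: poly_zero_fun => x.
    pose w (i : 'I_n.+1) := if unlift ord_max i is Some j then v j else x.
    rewrite -(p0 w) mevalE /q horner_sum; apply: eq_bigr => m _.
    rewrite hornerZ hornerXn -mulrA; congr (_ * _).
    rewrite big_ord_recr /= /w unlift_none; congr (_ * _).
    apply: eq_bigr => i _; rewrite /rest mnmE.
    have -> : widen_ord (leqnSn n) i = lift ord_max i.
      by apply: val_inj; rewrite /= /bump leqNgt ltn_ord add0n.
    by rewrite liftK.
  have /(congr1 (fun s : {poly R} => s`_e)) := q0.
  rewrite coef0 /q coef_sum /r raddf_sum /= => q0e.
  rewrite -[RHS]q0e [RHS](bigID (fun m : multinom n.+1 => m ord_max == e)) /= [X in _ + X]big1 ?addr0.
    apply: eq_bigr => m /eqP me.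
    by rewrite mevalZ mevalX coefZ coefXn me eqxx mulr1.
  by move=> m me; rewrite coefZ coefXn eq_sym (negPf me) mulr0.
apply/mpolyP => m; rewrite mcoeff0.
have /mpolyP /(_ (rest m)) := r0 (m ord_max).
rewrite mcoeff0 /r raddf_sum /= => s0.
have [mp|/memN_msupp_eq0 //] := boolP (m \in msupp p).
rewrite -s0 (big_rem m) //= eqxx mcoeffZ mcoeffX eqxx mulr1 big_seq_cond big1 ?addr0 // => m'.
rewrite mem_rem_uniq ?msupp_uniq // inE => /andP[/andP[/eqP mm _] /eqP eme].
rewrite mcoeffZ mcoeffX; case: eqP => [erest|]; last by rewrite mulr0.
case: mm; apply/mnmP => i; case: (unliftP ord_max i) => [j ->|-> //].
have -> : lift ord_max j = widen_ord (leqnSn n) j.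
  by apply: val_inj; rewrite /= /bump leqNgt ltn_ord add0n.
by move/mnmP: erest => /(_ j); rewrite !mnmE.
Qed.

(** * Laurent functions and the chain rule along curves of jets *)

(* Values off [dom] are irrelevant, so [1 / d] may be a junk value there. *)
Section Laurent.
Context {R : realType} {T : Type}.
Variables (c : nat -> T -> R) (dom : T -> Prop) (d : T -> R).

(** [n] bounds the coordinates that may occur. [laurent_ext] admits any function that has a Laurent
    formula on [dom], which is how [Dx F], defined by a limit, enters the class. *)
Inductive laurent (n : nat) : (T -> R) -> Prop :=
| laurent_cst a : laurent n (fun=> a)
| laurent_var i : (i < n)%N -> laurent n (c i)
| laurent_inv : laurent n (fun t => (d t)^-1)
| laurent_add F G : laurent n F -> laurent n G -> laurent n (fun t => F t + G t)
| laurent_mul F G : laurent n F -> laurent n G -> laurent n (fun t => F t * G t)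
| laurent_ext F G : laurent n F -> (forall t, dom t -> F t = G t) -> laurent n G.

Lemma laurent_exp n F e : laurent n F -> laurent n (fun t => F t ^+ e).
Proof.
move=> lF; elim: e => [|e IH].
  by apply: laurent_ext (laurent_cst n 1) _ => t _; rewrite expr0.
by apply: laurent_ext (laurent_mul lF IH) _ => t _; rewrite exprS.
Qed.

Lemma laurent_widen n n' F : (n <= n')%N -> laurent n F -> laurent n' F.
Proof.
move=> nn'; elim=> {F} [a|i ilt||F G _ ? _ ?|F G _ ? _ ?|F G _ lF FG].
- exact: laurent_cst.
- by apply: laurent_var; apply: leq_trans nn'.
- exact: laurent_inv.
- exact: laurent_add.
- exact: laurent_mul.
- exact: laurent_ext lF FG.
Qed.

Lemma laurent_sub n F G : laurent n F -> laurent n G -> laurent n (fun t => F t - G t).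
Proof.
move=> lF lG.
apply: laurent_ext (laurent_add lF (laurent_mul (laurent_cst n (-1)) lG)) _ => t _.
by rewrite mulN1r.
Qed.

Lemma laurent_sum n (I : Type) (s : seq I) (F : I -> T -> R) :
  (forall i, laurent n (F i)) -> laurent n (fun t => \sum_(i <- s) F i t).
Proof.
move=> lF; elim: s => [|i s IH].
  by apply: laurent_ext (laurent_cst n 0) _ => t _; rewrite big_nil.
by apply: laurent_ext (laurent_add (lF i) IH) _ => t _; rewrite big_cons.
Qed.

Lemma laurent_prod n (I : Type) (s : seq I) (F : I -> T -> R) :
  (forall i, laurent n (F i)) -> laurent n (fun t => \prod_(i <- s) F i t).
Proof.
move=> lF; elim: s => [|i s IH].
  by apply: laurent_ext (laurent_cst n 1) _ => t _; rewrite big_nil.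
by apply: laurent_ext (laurent_mul (lF i) IH) _ => t _; rewrite big_cons.
Qed.

Lemma laurent_meval n m (F : 'I_m -> T -> R) (P : mpoly m R) :
  (forall i, laurent n (F i)) -> laurent n (fun t => meval (F^~ t) P).
Proof.
move=> lF.
suff l : laurent n (fun t => \sum_(e <- msupp P)
    (mcoeff e P * \prod_(i <- index_enum 'I_m) F i t ^+ e i)).
  by apply: laurent_ext l _ => t _; rewrite mevalE.
apply: laurent_sum => e; apply: laurent_mul; first exact: laurent_cst.
by apply: laurent_prod => i; apply: laurent_exp.
Qed.

(** The way back to [mpoly]: common denominators are powers of [d], and cross-multiplying by them
    stays polynomial because [d] is itself a polynomial [D] in the same variables. *)
Lemma laurent_normal n (D : mpoly n R) F :
  (forall t, dom t -> d t = meval (fun i => c i t) D) ->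
  (forall t, dom t -> d t != 0) ->
  laurent n F ->
  exists (P : mpoly n R) (e : nat),
    forall t, dom t -> F t = meval (fun i => c i t) P / d t ^+ e.
Proof.
move=> dE d0.
elim=> {F} [a|i ilt||F G _ [P [e FE]] _ [Q [e' GE]]|F G _ [P [e FE]] _ [Q [e' GE]]|F G _ [P [e FE]] FG].
- by exists (mpolyC n a), 0%N => t _; rewrite mevalC expr0 divr1.
- by exists (mpolyX R (mnm1 (Ordinal ilt))), 0%N => t _; rewrite mevalXU expr0 divr1.
- by exists 1, 1%N => t _; rewrite meval1 expr1 mul1r.
- exists (P * D ^+ e' + Q * D ^+ e), (e + e')%N => t dt.
  rewrite FE // GE // mevalD !mevalM !rmorphXn /= -!dE // exprD.
  have := d0 t dt; move: (d t) => a a0; field.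
  by rewrite !expf_neq0.
- exists (P * Q), (e + e')%N => t dt.
  rewrite FE // GE // mevalM exprD.
  have := d0 t dt; move: (d t) => a a0; field.
  by rewrite !expf_neq0.
- by exists P, e => t dt; rewrite -FG // FE.
Qed.

Lemma laurent_local n F z z' :
  laurent n F -> dom z -> dom z' -> d z = d z' ->
  (forall i, (i < n)%N -> c i z = c i z') -> F z = F z'.
Proof.
move=> lF dz dz' dd cc.
elim: lF => {F} [a|i ilt||F G _ FE _ GE|F G _ FE _ GE|F G _ FE FG] //.
- exact: cc.
- by rewrite dd.
- by rewrite FE GE.
- by rewrite FE GE.
- by rewrite -!FG.
Qed.

End Laurent.

(** With [s := id] this rewrites a function from one system of coordinates, domain and denominator
    to another. *)
Lemma laurent_comp (R : realType) (T T' : Type) (c : nat -> T -> R) dom d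
    (c' : nat -> T' -> R) dom' d' n n' (s : T' -> T) F :
  laurent c dom d n F ->
  (forall t, dom' t -> dom (s t)) ->
  (forall i, (i < n)%N -> laurent c' dom' d' n' (c i \o s)) ->
  laurent c' dom' d' n' (fun t => (d (s t))^-1) ->
  laurent c' dom' d' n' (F \o s).
Proof.
move=> lF doms lc ld.
elim: lF => {F} [a|i ilt||F G _ ? _ ?|F G _ ? _ ?|F G _ lF FG].
- exact: laurent_cst.
- exact: lc.
- exact: ld.
- exact: (@laurent_add _ _ _ _ _ _ (F \o s) (G \o s)).
- exact: (@laurent_mul _ _ _ _ _ _ (F \o s) (G \o s)).
- by apply: laurent_ext lF _ => t dt /=; apply: FG; apply: doms.
Qed.

(** * The total derivative along curves of jets *)

Section Jets.
Context {R : realType}.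
Implicit Types (z : jet R) (F G : jet R -> R) (g : R -> jet R).

(** Index 0 is [x], so [y_l] is coordinate [l.+1] and order [k] means [k.+2] coordinates, as in
    [mpoly k.+2]. *)
Definition coord (i : nat) z : R := if i is l.+1 then jy z l else jx z.

Definition dcoord (i : nat) z : R := if i is l.+1 then jy z l.+1 else 1.

Definition jline z t := Jet (jx z + t) (fun l => jy z l + t * jy z l.+1).

(** The velocity of [g] is [a] times the vector field [D_x], whose components are [dcoord]. The
    factor [a] is there because the group rescales [D_x]. *)
Definition tangent g (t0 a : R) : Prop :=
  forall i, is_derive t0 1 (coord i \o g) (a * dcoord i (g t0)).

Lemma jline0 z : jline z 0 = z.
Proof.
case: z => x y; rewrite /jline /= addr0; congr Jet.
by apply/funext => l; rewrite mul0r addr0.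
Qed.

Lemma tangent_jline z : tangent (jline z) 0 1.
Proof.
move=> i; rewrite jline0 mul1r; case: i => [|l].
  have -> : coord 0 \o jline z = cst (jx z) + id by [].
  by apply: is_derive_eq; rewrite add0r.
have -> : coord l.+1 \o jline z = cst (jy z l) + id * cst (jy z l.+1) by [].
by apply: is_derive_eq; rewrite /= scaler0 !add0r /GRing.scale /= mulr1.
Qed.

Lemma DxE F z : Dx F z = 'D_1 (F \o jline z) 0.
Proof. by rewrite /Dx derive1E. Qed.

Section Chain.
Variables (d D : jet R -> R) (n0 : nat).
Hypothesis lD : forall n, (n0 <= n)%N -> laurent coord (fun z => d z != 0) d n D.
Hypothesis dD : forall g t0 a, tangent g t0 a ->
  is_derive t0 1 (d \o g) (a * D (g t0)).

Lemma tangent_near g t0 a : tangent g t0 a -> d (g t0) != 0 ->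
  \forall t \near t0, d (g t) != 0.
Proof.
move=> /dD [+ _] d0 => /derivable1_diffP /differentiable_continuous cd.
apply: (cd (fun x : R => x != 0)).
exists `|d (g t0)|; first by rewrite /= normr_gt0.
move=> y /= ylt; apply/eqP => y0.
by rewrite y0 subr0 ltxx in ylt.
Qed.

(** The derivative [F'] is built by induction on the formula, hence is the same for all curves [g];
    the jet line then identifies it with [Dx F]. The bound [n0] leaves room for the coordinates in
    the derivative [D] of the denominator. *)
Let chain n F : (n0 <= n.+1)%N -> laurent coord (fun z => d z != 0) d n F ->
  exists2 F' : jet R -> R, laurent coord (fun z => d z != 0) d n.+1 F' &
    forall g t0 a, tangent g t0 a -> d (g t0) != 0 ->
    is_derive t0 1 (F \o g) (a * F' (g t0)).
Proof.
move=> n0n.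
elim=> {F} [a|i ilt||F G lF [F' lF' FE] lG [G' lG' GE]|F G lF [F' lF' FE] lG [G' lG' GE]|F G _ [F' lF' FE] FG].
- exists (fun=> 0); first exact: laurent_cst.
  move=> g t0 b _ _; rewrite mulr0.
  exact: is_derive_cst.
- exists (dcoord i); last by move=> g t0 a tg _; apply: tg.
  case: i ilt => [|i] ilt; first exact: laurent_cst.
  exact: (@laurent_var _ _ _ _ _ _ i.+2).
- exists (fun z => -1 * (d z)^-1 ^+ 2 * D z).
    apply: laurent_mul; last exact: lD.
    apply: laurent_mul; first exact: laurent_cst.
    by apply: laurent_exp; apply: laurent_inv.
  move=> g t0 a tg d0; have dg := dD tg.
  apply: DeriveDef.
    by apply: (@derivableV _ _ (d \o g)) => //; case: dg.
  rewrite (@deriveV _ _ (d \o g)) //.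
  rewrite derive_val /= /GRing.scale /= exprVn; ring.
- exists (fun z => F' z + G' z); first exact: laurent_add.
  move=> g t0 a tg d0; have := FE _ _ _ tg d0; have := GE _ _ _ tg d0 => ? ?.
  rewrite mulrDr; exact: (@is_deriveD _ _ _ (F \o g) (G \o g)).
- exists (fun z => F z * G' z + G z * F' z).
    apply: laurent_add; apply: laurent_mul => //; exact: (laurent_widen (leqnSn n)).
  move=> g t0 a tg d0; have hF := FE _ _ _ tg d0; have hG := GE _ _ _ tg d0.
  have -> : (fun z => F z * G z) \o g = (F \o g) * (G \o g) by [].
  apply: (is_derive_eq (is_deriveM hF hG)).
  rewrite /GRing.scale /=; ring.
(* [F] and [G] agree only off the zeros of [d], an open condition along [g], which suffices for
   derivatives. *)
- exists F' => // g t0 a tg d0.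
  apply: near_eq_is_derive (FE _ _ _ tg d0).
  have := tangent_near tg d0; apply: filterS => t; exact: FG.
Qed.

Lemma laurent_Dx n F : (n0 <= n.+1)%N -> laurent coord (fun z => d z != 0) d n F ->
  laurent coord (fun z => d z != 0) d n.+1 (Dx F).
Proof.
move=> n0n /(chain n0n) [F' lF' FE].
apply: laurent_ext lF' _ => z d0.
have := FE _ _ _ (tangent_jline z); rewrite jline0 => /(_ d0) [_].
by rewrite mul1r DxE.
Qed.

Lemma is_derive_tangent n F g t0 a :
  laurent coord (fun z => d z != 0) d n F ->
  tangent g t0 a -> d (g t0) != 0 -> is_derive t0 1 (F \o g) (a * Dx F (g t0)).
Proof.
move=> /(laurent_widen (leq_addl n0 n)) /(chain (leqW (leq_addr _ _))) [F' lF' FE] tg d0.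
have := FE _ _ _ (tangent_jline (g t0)); rewrite jline0 => /(_ d0) [_].
by rewrite DxE mul1r => ->; apply: FE.
Qed.

End Chain.
End Jets.

(** * The prolonged action *)

Section Action.
Context {R : realType}.
Implicit Types (z : jet R) (F G : jet R -> R) (g : R -> jet R).
Implicit Types h k : 'M[R]_2 * 'cV[R]_2.

Lemma ord2P (i : 'I_2) : i = 0 \/ i = 1.
Proof. by case: i => [[|[|//]] ilt]; [left|right]; apply: val_inj. Qed.

Lemma mulmx2E (S : pzSemiRingType) (A : 'M[S]_2) (u : 'cV[S]_2) i :
  (A *m u) i 0 = A i 0 * u 0 0 + A i 1 * u 1 0.
Proof.
by rewrite mxE big_ord_recl big_ord1; congr (A i _ * u _ _ + A i _ * u _ _); apply: val_inj.
Qed.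

Lemma symplectic_det (A : 'M[R]_2) :
  symplectic A <-> A 0 0 * A 1 1 - A 0 1 * A 1 0 = 1.
Proof.
split=> [sA|dA].
  have := sA (\col_i (i == 0)%:R) (\col_i (i == 1)%:R).
  rewrite /omega !mulmx2E !mxE /= ?(mulr0, mulr1, addr0, add0r, subr0) => e; apply: etrans e; ring.
move=> u v; rewrite /omega !mulmx2E.
transitivity ((A 0 0 * A 1 1 - A 0 1 * A 1 0) * (u 0 0 * v 1 0 - u 1 0 * v 0 0)); first ring.
by rewrite dA mul1r.
Qed.

Definition affx h z : R := h.1 0 0 * jx z + h.1 0 1 * jy z 0 + h.2 0 0.
Definition affy h z : R := h.1 1 0 * jx z + h.1 1 1 * jy z 0 + h.2 1 0.
Definition slope h z : R := h.1 0 0 + h.1 0 1 * jy z 1.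

(** The classical prolongation formula [y'_(l+1) = D_x y'_l / D_x x'], as [slope h] is [D_x] of
    [affx h]. *)
Fixpoint prol h (l : nat) : jet R -> R :=
  if l is l'.+1 then fun z => Dx (prol h l') z / slope h z else affy h.

Definition act h z : jet R := Jet (affx h z) (fun l => prol h l z).

Lemma is_derive_affine g t0 a (b c e : R) : tangent g t0 a ->
  is_derive t0 1 (fun t => b * jx (g t) + c * jy (g t) 0 + e)
    (a * (b + c * jy (g t0) 1)).
Proof.
move=> tg; have t1 := tg 0%N; have t2 := tg 1%N.
have -> : (fun t => b * jx (g t) + c * jy (g t) 0 + e) =
  cst b * (coord 0 \o g) + cst c * (coord 1 \o g) + cst e by [].
apply: is_derive_eq; rewrite !scaler0 !addr0 /cst /= /GRing.scale /=; ring.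
Qed.

Lemma is_derive_slope h g t0 a : tangent g t0 a ->
  is_derive t0 1 (slope h \o g) (a * (h.1 0 1 * jy (g t0) 2)).
Proof.
move=> tg; have t2 := tg 2%N.
have -> : slope h \o g = cst (h.1 0 0) + cst (h.1 0 1) * (coord 2 \o g) by [].
apply: is_derive_eq; rewrite !scaler0 !addr0 add0r /cst /= /GRing.scale /=; ring.
Qed.

Lemma laurent_dslope h n : (4 <= n)%N ->
  laurent coord (fun z => slope h z != 0) (slope h) n (fun z => h.1 0 1 * jy z 2).
Proof.
move=> n4; apply: laurent_mul; first exact: laurent_cst.
exact: (@laurent_var _ _ _ _ _ _ 3).
Qed.

Lemma Dx_affy h z : Dx (affy h) z = h.1 1 0 + h.1 1 1 * jy z 1.
Proof.
have := @is_derive_affine _ _ _ (h.1 1 0) (h.1 1 1) (h.2 1 0) (tangent_jline z).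
by rewrite jline0 mul1r DxE => -[_ <-].
Qed.

Lemma laurent_affy h d dom n : (2 <= n)%N -> laurent coord dom d n (affy h).
Proof.
move=> n2; apply: (@laurent_add _ _ _ _ _ _ (fun z => _ * jx z + _ * jy z 0) (fun=> h.2 1 0)); last exact: laurent_cst.
apply: laurent_add; apply: laurent_mul; try exact: laurent_cst.
  by apply: (@laurent_var _ _ _ _ _ _ 0); apply: leq_trans n2.
exact: (@laurent_var _ _ _ _ _ _ 1).
Qed.

Lemma laurent_prolS h l :
  laurent coord (fun z => slope h z != 0) (slope h) l.+3 (prol h l.+1).
Proof.
elim: l => [|l IH].
  apply: (@laurent_mul _ _ _ _ _ _ _ (fun z => (slope h z)^-1)); last exact: laurent_inv.
  apply: (@laurent_ext _ _ _ _ _ _ (fun z => h.1 1 0 + h.1 1 1 * jy z 1)).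
    apply: laurent_add; first exact: laurent_cst.
    apply: laurent_mul; first exact: laurent_cst.
    exact: (@laurent_var _ _ _ _ _ _ 2).
  by move=> z _; rewrite Dx_affy.
apply: (@laurent_mul _ _ _ _ _ _ _ (fun z => (slope h z)^-1)); last exact: laurent_inv.
by apply: laurent_Dx IH; [exact: laurent_dslope|exact: is_derive_slope|].
Qed.

Lemma laurent_prol h l :
  laurent coord (fun z => slope h z != 0) (slope h) l.+2 (prol h l).
Proof. by case: l => [|l]; [exact: laurent_affy|exact: laurent_prolS]. Qed.

Lemma is_derive_prol h l g t0 a : tangent g t0 a -> slope h (g t0) != 0 ->
  is_derive t0 1 (prol h l \o g) (a * slope h (g t0) * prol h l.+1 (g t0)).
Proof.
move=> tg d0 /=; rewrite -mulrA [slope _ _ * _]mulrCA divff // mulr1.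
exact: (@is_derive_tangent _ _ (fun z => h.1 0 1 * jy z 2) _ (@laurent_dslope h) (@is_derive_slope h) _ _ _ _ _ (laurent_prol h l) tg d0).
Qed.

(** Division by [slope h] in the recursion makes each image coordinate change at [slope h] times the
    next one, so the action preserves the line spanned by [D_x]. *)
Lemma tangent_act h g t0 a : tangent g t0 a -> slope h (g t0) != 0 ->
  tangent (act h \o g) t0 (a * slope h (g t0)).
Proof.
move=> tg d0 [|l] /=; last exact: is_derive_prol.
rewrite mulr1; exact: is_derive_affine.
Qed.

Lemma slope_near h g t0 a : tangent g t0 a -> slope h (g t0) != 0 ->
  \forall t \near t0, slope h (g t) != 0.
Proof.
exact: (@tangent_near _ _ (fun z => h.1 0 1 * jy z 2) (@is_derive_slope h)).
Qed.

Definition hcomp k h : 'M[R]_2 * 'cV[R]_2 := (k.1 *m h.1, k.1 *m h.2 + k.2).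

Lemma mulmx22E (S : pzSemiRingType) (A B : 'M[S]_2) i j :
  (A *m B) i j = A i 0 * B 0 j + A i 1 * B 1 j.
Proof.
by rewrite mxE big_ord_recl big_ord1; congr (A i _ * B _ _ + A i _ * B _ _); apply: val_inj.
Qed.

Lemma affx_hcomp k h z : affx (hcomp k h) z = affx k (act h z).
Proof. rewrite /affx /= /affx /affy !mulmx22E mxE mulmx2E; ring. Qed.

Lemma affy_hcomp k h z : affy (hcomp k h) z = affy k (act h z).
Proof. rewrite /affy /= /affx /affy !mulmx22E mxE mulmx2E; ring. Qed.

Lemma slope_hcomp k h z : slope h z != 0 ->
  slope (hcomp k h) z = slope k (act h z) * slope h z.
Proof.
move=> h0; rewrite {2}/slope /= Dx_affy mulrDl -mulrA mulfVK //.
rewrite /slope /= !mulmx22E; ring.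
Qed.

(** Induction on [l], differentiating the previous identity along the jet line through [z]. That
    identity holds only where both slopes are nonzero, which is an open condition on the line. *)
Lemma prol_hcomp k h l z : slope h z != 0 -> slope k (act h z) != 0 ->
  prol (hcomp k h) l z = prol k l (act h z).
Proof.
elim: l z => [|l IH] z h0 k0; first exact: affy_hcomp.
rewrite /= slope_hcomp //.
have tz : tangent (act h \o jline z) 0 (slope h z).
  by rewrite -[slope h z]mul1r -{2}[z]jline0; apply: tangent_act (tangent_jline z) _; rewrite jline0.
have := @is_derive_prol k l _ _ _ tz; rewrite /= jline0 => /(_ k0) [_ dE].
suff -> : Dx (prol (hcomp k h) l) z = slope h z * slope k (act h z) * (Dx (prol k l) (act h z) / slope k (act h z)).
  by field; rewrite h0 k0.
rewrite -dE DxE; apply: near_eq_derive.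
have n1 := slope_near (tangent_jline z); rewrite jline0 in n1.
have n2 := slope_near tz; rewrite /= jline0 in n2.
near=> t; rewrite /=; apply: IH.
  by near: t; apply: n1.
by near: t; apply: n2.
Unshelve. all: by end_near. Qed.

Lemma act_hcomp k h z : slope h z != 0 -> slope k (act h z) != 0 ->
  act (hcomp k h) z = act k (act h z).
Proof.
move=> h0 k0; rewrite {1 2}/act affx_hcomp; congr Jet; apply/funext => l.
exact: prol_hcomp.
Qed.

Lemma Dx_jy l z : Dx (fun w => jy w l) z = jy z l.+1.
Proof.
by have := tangent_jline z l.+1; rewrite jline0 mul1r DxE => -[_].
Qed.

Lemma act1 z : act (1%:M, 0) z = z.
Proof.
have s1 w : slope (1%:M, 0) w = 1 by rewrite /slope /= !mxE /= mul0r addr0.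
have E l : prol (1%:M, 0) l = fun w => jy w l.
  elim: l => [|l IH]; apply/funext => w.
    by rewrite /= /affy /= !mxE /= mul0r mul1r add0r addr0.
  by rewrite /= s1 divr1 IH Dx_jy.
case: z => x y; rewrite /act /affx /= !mxE /= mul0r mul1r !addr0; congr Jet.
by apply/funext => l; rewrite E.
Qed.

Lemma ASp_hcomp k h : ASp k -> ASp h -> ASp (hcomp k h).
Proof. by move=> sk sh u v; rewrite /= -!mulmxA sk sh. Qed.

Lemma ASp_inv h : ASp h -> exists2 k, ASp k & hcomp k h = (1%:M, 0).
Proof.
move=> /symplectic_det dh.
(* The adjugate, which inverts a matrix of determinant 1. *)
pose B : 'M[R]_2 := \matrix_(i, j) if i == 0 then (if j == 0 then h.1 1 1 else - h.1 0 1)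
   else (if j == 0 then - h.1 1 0 else h.1 0 0).
have BA : B *m h.1 = 1%:M.
  apply/matrixP => i j; rewrite mulmx22E !mxE.
  case: (ord2P i) => ->; case: (ord2P j) => -> /=; rewrite ?mulr1n ?mulr0n -?dh; ring.
exists (B, - (B *m h.2)); last by rewrite /hcomp /= BA addrN.
apply/symplectic_det; rewrite /= !mxE /= -dh; ring.
Qed.

End Action.

(** * Prolongation as contact of curves *)

Section Contact.
Context {R : realType}.
Implicit Types (z : jet R) (p u v : {poly R}).
Implicit Types h : 'M[R]_2 * 'cV[R]_2.

Lemma derivn_dvdp p (x : R) k j :
  (j <= k)%N -> ('X - x%:P) ^+ k %| p -> ('X - x%:P) ^+ (k - j) %| p^`(j).
Proof.
move=> + pk; elim: j => [|j IH] jk; first by rewrite subn0.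
rewrite derivnS; have /dvdpP[q ->] := IH (ltnW jk).
rewrite derivM deriv_exp derivXsubC mul1r -subnS.
apply: dvdp_add.
  by apply: dvdp_mull; apply: dvdp_exp2l; rewrite leq_sub2l.
by rewrite -mulr_natl; do 2!apply: dvdp_mull.
Qed.

(** Taylor expansion at [x]; it turns contact of order [k], a divisibility, into equations on
    derivatives. *)
Lemma dvdp_XsubC_expP p (x : R) k :
  ('X - x%:P) ^+ k.+1 %| p <-> forall j, (j <= k)%N -> p^`(j).[x] = 0.
Proof.
split=> [pk j jk|pj].
  have := derivn_dvdp (leqW jk) pk; rewrite subSn // exprS.
  move=> /(dvdp_trans (dvdp_mulIl _ _)); rewrite dvdp_XsubCl => /rootP //.
have -> : p = \sum_(i < size p) (p^`N(i).[x])%:P * ('X - x%:P) ^+ i.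
  apply/eqP; rewrite -subr_eq0; apply/eqP/poly_zero_fun => y.
  rewrite hornerD hornerN horner_sum -{1}(subrK x y) addrC [y - x + x]addrC.
  rewrite nderiv_taylor; last exact: mulrC.
  rewrite addrC; apply/eqP; rewrite subr_eq0; apply/eqP; apply: eq_bigr => i _.
  by rewrite !hornerE.
apply: (big_ind (fun q => ('X - x%:P) ^+ k.+1 %| q)) => [|a b|i _]; [exact: dvdp0|exact: dvdp_add|].
have [ik|ki] := leqP i k; last by apply: dvdp_mull; apply: dvdp_exp2l.
have := pj i ik; rewrite nderivn_def hornerMn => /eqP.
rewrite mulrn_eq0 -leqn0 leqNgt fact_gt0 /= => /eqP ->.
by rewrite polyC0 mul0r dvdp0.
Qed.

Lemma derivn_XsubC_exp (x : R) i l :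
  (('X - x%:P) ^+ i)^`(l) = ('X - x%:P) ^+ (i - l) *+ i ^_ l.
Proof.
elim: l => [|l IH]; first by rewrite subn0 mulr1n.
rewrite derivnS IH derivMn deriv_exp derivXsubC mul1r -subnS -mulrnA.
by rewrite ffactnSr mulnC.
Qed.

Lemma derivn_taylor k z l : (l <= k)%N -> (taylor k z)^`(l).[jx z] = jy z l.
Proof.
move=> lk; rewrite /taylor linear_sum /= horner_sum.
rewrite (bigD1 (Ordinal (lk : (l < k.+1)%N))) //= big1 ?addr0.
  rewrite linearZ /= derivn_XsubC_exp subnn expr0 ffactnn hornerZ hornerMn hornerC.
  by rewrite divfK // pnatr_eq0 -lt0n fact_gt0.
move=> i /eqP il; rewrite linearZ /= derivn_XsubC_exp hornerZ hornerMn horner_exp.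
rewrite hornerXsubC subrr expr0n.
have [il'|li|e] := ltngtP i l; last by case: il; apply: val_inj.
  by rewrite ffact_small // mulr0n mulr0.
by rewrite subn_eq0 leqNgt li mul0rn mulr0.
Qed.

(** The infinite jet of the graph of [u] at [t]; as [t] varies it is an integral curve of [D_x]. *)
Definition pjet u t : jet R := Jet t (fun l => u^`(l).[t]).

Lemma tangent_pjet u t : tangent (pjet u) t 1.
Proof.
case=> [|l]; rewrite mul1r.
  have -> : coord 0 \o pjet u = id by [].
  exact: is_derive_id.
have -> : coord l.+1 \o pjet u = horner u^`(l) by [].
exact: is_derive_poly.
Qed.

Section Curve.
Variables (h : 'M[R]_2 * 'cV[R]_2) (u v : {poly R}).

Let X := moved_graph h u 0 0.
Let Y := moved_graph h u 1 0.

Lemma moved_graphE i :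
  moved_graph h u i 0 = (h.1 i 0)%:P * 'X + (h.1 i 1)%:P * u + (h.2 i 0)%:P.
Proof. by rewrite /moved_graph mxE mulmx2E !mxE. Qed.

Let defect l t := v^`(l).[X.[t]] - prol h l (pjet u t).

Lemma slope_pjet t : X^`().[t] = slope h (pjet u t).
Proof.
rewrite /X moved_graphE /slope /= derivD derivC addr0 derivD !derivM !derivC derivX !mul0r !add0r mulr1.
by rewrite hornerD hornerM !hornerC.
Qed.

Lemma affx_pjet t : X.[t] = affx h (pjet u t).
Proof. by rewrite /X moved_graphE /affx /= !hornerE. Qed.

Lemma affy_pjet t : Y.[t] = affy h (pjet u t).
Proof. by rewrite /Y moved_graphE /affy /= !hornerE. Qed.

Let is_derive_defect l t : slope h (pjet u t) != 0 ->
  is_derive t 1 (defect l) (X^`().[t] * defect l.+1 t).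
Proof.
move=> s0.
have d1 := is_derive_prol l (tangent_pjet u t) s0.
have -> : defect l = horner (v^`(l) \Po X) - (prol h l \o pjet u).
  by apply/funext => w; rewrite /defect !fctE horner_comp.
apply: is_derive_eq; rewrite deriv_comp hornerM horner_comp -derivnS.
by rewrite mul1r slope_pjet /defect mulrBr [X in X - _]mulrC.
Qed.

(** Since [defect 0] is [v \Po X - Y] and each [defect l] has derivative [X'] times [defect l.+1],
    the Leibniz rule gives a triangular system with diagonal entries [X' ^+ j]. *)
Let derivn_contact j : exists2 c : nat -> {poly R}, c j = X^`() ^+ j &
  forall t, slope h (pjet u t) != 0 ->
    ((v \Po X) - Y)^`(j).[t] = \sum_(l < j.+1) (c l).[t] * defect l t.
Proof.
elim: j => [|j [c cj cE]].
  exists (fun=> 1) => [|t _]; first by rewrite expr0.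
  rewrite big_ord_recl big_ord0 addr0 hornerC mul1r /defect /= -affy_pjet.
  by rewrite hornerD hornerN horner_comp.
(* One term differentiates the coefficient, the other the defect. The cut-off discards the
   unspecified values of [c] past [j], so that the new diagonal entry is exactly [X' ^+ j.+1]. *)
exists (fun l => (if (l <= j)%N then (c l)^`() else 0) +
                 (if l is l'.+1 then c l' * X^`() else 0)).
  by rewrite ltnn add0r cj exprSr.
move=> t s0.
have dl : is_derive t 1 (horner ((v \Po X - Y)^`(j))) ((v \Po X - Y)^`(j.+1)).[t].
  by rewrite derivnS; apply: is_derive_poly.
have dr : is_derive t 1 (\sum_(l < j.+1) (horner (c l) * defect l))
    (\sum_(l < j.+1) ((c l).[t] * (X^`().[t] * defect l.+1 t) + defect l t * (c l)^`().[t])).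
  apply: is_derive_sum => l.
  have := is_derive_defect l s0 => ?.
  exact: is_deriveM.
transitivity ('D_1 (horner ((v \Po X - Y)^`(j))) t); first by case: dl.
rewrite (_ : 'D_1 _ t = 'D_1 (\sum_(l < j.+1) (horner (c l) * defect l)) t); last first.
  apply: near_eq_derive.
  have := slope_near (tangent_pjet u t) s0; apply: filterS => w sw.
  by rewrite cE // fct_sumE.
rewrite derive_val big_split /= addrC.
under [RHS]eq_bigr do rewrite hornerD mulrDl.
rewrite big_split /= [X in _ = X + _]big_ord_recr [X in _ = _ + X]big_ord_recl /=.
rewrite ltnn horner0 !mul0r addr0 add0r; congr (_ + _); apply: eq_bigr => l _.
  by rewrite -ltnS ltn_ord mulrC.
by rewrite hornerM mulrA.
Qed.

(** The diagonal of the triangular system consists of powers of the slope, so for nonzero slope the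
    derivatives vanish up to order [k] exactly when the defects do. *)
Lemma contactP k x : slope h (pjet u x) != 0 ->
  ('X - x%:P) ^+ k.+1 %| (v \Po X) - Y <->
  forall l, (l <= k)%N -> v^`(l).[X.[x]] = prol h l (pjet u x).
Proof.
move=> s0; apply: iff_trans (dvdp_XsubC_expP _ _ _) _; split=> H.
  elim/ltn_ind => l IH lk.
  have := H l lk; have [c cl ->] := derivn_contact l => //.
  rewrite big_ord_recr /= big1 ?add0r; last first.
    by move=> i _; rewrite /defect IH ?subrr ?mulr0 // ltnW // (leq_trans (ltn_ord i)).
  rewrite cl horner_exp => /eqP; rewrite mulf_eq0 expf_eq0 slope_pjet (negPf s0) andbF /=.
  by rewrite subr_eq0 => /eqP.
move=> j jk; have [c _ ->] := derivn_contact j => //.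
rewrite big1 // => i _; rewrite /defect H ?subrr ?mulr0 //.
by apply: leq_trans jk; rewrite -ltnS.
Qed.

End Curve.

Lemma prolongs0 h z z' :
  prolongs 0 h z z' <-> jx z' = h.1 0 0 * jx z + h.1 0 1 * jy z 0 + h.2 0 0 /\ jy z' 0 = affy h z.
Proof.
have tay w : taylor 0 w = (jy w 0)%:P.
  by rewrite /taylor big_ord_recl big_ord0 /= addr0 divr1 expr0 alg_polyC.
rewrite /prolongs !tay expr1 dvdp_XsubCl comp_polyC !moved_graphE !hornerE.
rewrite /root !hornerE subr_eq0 -/(affy h z).
by split=> -[-> /eqP ->].
Qed.

Lemma pjet_taylor k z l : (l <= k)%N -> jy (pjet (taylor k z) (jx z)) l = jy z l.
Proof. exact: derivn_taylor. Qed.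

Lemma slope_taylor k z h : (0 < k)%N ->
  slope h (pjet (taylor k z) (jx z)) = slope h z.
Proof. by move=> k0; rewrite /slope pjet_taylor. Qed.

Lemma prol_taylor k z h l : (0 < k)%N -> (l <= k)%N -> slope h z != 0 ->
  prol h l (pjet (taylor k z) (jx z)) = prol h l z.
Proof.
move=> k0 lk s0.
have E i : (i < k.+2)%N -> coord i (pjet (taylor k z) (jx z)) = coord i z.
  by case: i => [|i] ik //=; apply: derivn_taylor.
apply: (laurent_local (laurent_prol h l)); rewrite ?slope_taylor //.
by move=> i il; apply: E; apply: leq_trans il _.
Qed.

Lemma prolongsP k h z z' : (0 < k)%N -> slope h z != 0 ->
  prolongs k h z z' <->
  jx z' = affx h z /\ forall l, (l <= k)%N -> jy z' l = prol h l z.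
Proof.
move=> k0 s0.
have Xz : (moved_graph h (taylor k z) 0 0).[jx z] = affx h z.
  by rewrite affx_pjet /affx pjet_taylor.
have cP := contactP (taylor k z') k; rewrite /prolongs Xz.
have s1 : slope h (pjet (taylor k z) (jx z)) != 0 by rewrite slope_taylor.
have {}cP := cP _ _ _ s1; split=> -[ze H]; split=> //.
  move=> l lk; rewrite -(derivn_taylor _ lk) ze -Xz.
  by move/cP: H => -> //; rewrite prol_taylor.
apply/cP => l lk; rewrite Xz -ze derivn_taylor // H //.
by rewrite prol_taylor.
Qed.

Lemma prolongs_act k h z : slope h z != 0 -> prolongs k h z (act h z).
Proof.
move=> s0; case: k => [|k]; first by apply/prolongs0.
exact/prolongsP.
Qed.

(** An invertible map cannot kill the tangent vector of the graph: with [X' = 0], first-order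
    contact forces [Y' = 0] too, whereas [h.1 1 1 * X' - h.1 0 1 * Y'] is the determinant 1. *)
Lemma prolongs_slope k h z z' : (0 < k)%N -> ASp h -> prolongs k h z z' -> slope h z != 0.
Proof.
case: k => // k _ /symplectic_det dh [_ /dvdp_XsubC_expP H].
have := H 1%N isT; rewrite derivn1 derivB deriv_comp hornerD hornerN hornerM.
rewrite slope_pjet slope_taylor // => e.
apply/eqP => s0; move: e; rewrite s0 mulr0 sub0r moved_graphE => /eqP.
rewrite oppr_eq0 derivD derivC addr0 derivD !derivM !derivC derivX !mul0r !add0r mulr1.
rewrite hornerD hornerM !hornerC.
rewrite (_ : (taylor _ _)^`().[_] = jy z 1) => [/eqP|]; last exact: (@derivn_taylor k.+1 z 1).
move: s0; rewrite /slope => s0 e.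
have : h.1 1 1 * (h.1 0 0 + h.1 0 1 * jy z 1) - h.1 0 1 * (h.1 1 0 + h.1 1 1 * jy z 1) = 1.
  by rewrite -[RHS]dh; ring.
by rewrite s0 e !mulr0 subr0 => /eqP; rewrite eq_sym oner_eq0.
Qed.

Lemma prolongs_infP h z z' : ASp h ->
  prolongs_inf h z z' <-> slope h z != 0 /\ z' = act h z.
Proof.
move=> sh; split=> [H|[s0 ->] k]; last exact: prolongs_act.
have s0 := prolongs_slope (isT : (0 < 1)%N) sh (H 1%N).
split=> //; case: z' H => x y H.
have [/= -> _] : x = affx h z /\ _ := proj1 (prolongsP (Jet x y) (isT : (0 < 1)%N) s0) (H 1%N).
congr Jet; apply/funext => l.
by have [_ /(_ l (leqW (leqnn _)))] := proj1 (prolongsP (Jet x y) (isT : (0 < l.+1)%N) s0) (H l.+1).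
Qed.

End Contact.

(** * The iterated derivatives of the generator *)

Section DxRules.
Context {R : realType}.
Implicit Types (z : jet R) (F G : jet R -> R).

(** [Dx] has a value even where the limit fails to exist; [dx] also records differentiability, so
    that the rules below compose. *)
Definition dx F z (a : R) := is_derive (0 : R) (1 : R) (F \o jline z) a.

Lemma dxE F z a : dx F z a -> Dx F z = a.
Proof. by rewrite DxE; case. Qed.

Lemma dx_cst b z : dx (fun=> b) z 0.
Proof. exact: is_derive_cst. Qed.

Lemma dx_jy l z : dx (fun w => jy w l) z (jy z l.+1).
Proof. by have := tangent_jline z l.+1; rewrite mul1r jline0. Qed.

Lemma dxD F G z a b : dx F z a -> dx G z b -> dx (fun w => F w + G w) z (a + b).
Proof. by move=> ? ?; apply: (@is_deriveD _ _ _ (F \o jline z) (G \o jline z)). Qed.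

Lemma dxB F G z a b : dx F z a -> dx G z b -> dx (fun w => F w - G w) z (a - b).
Proof. by move=> ? ?; apply: (@is_deriveB _ _ _ (F \o jline z) (G \o jline z)). Qed.

Lemma dxM F G z a b : dx F z a -> dx G z b ->
  dx (fun w => F w * G w) z (F z * b + G z * a).
Proof.
move=> hF hG; rewrite /dx.
have -> : (fun w => F w * G w) \o jline z = (F \o jline z) * (G \o jline z) by [].
by apply: (is_derive_eq (is_deriveM hF hG)); rewrite /= jline0.
Qed.

Lemma dxX F e z a : dx F z a -> dx (fun w => F w ^+ e) z (e%:R * F z ^+ e.-1 * a).
Proof.
move=> hF; rewrite /dx.
have -> : (fun w => F w ^+ e) \o jline z = (F \o jline z) ^+ e.
  by apply/funext => t; rewrite exprfctE.
by apply: (is_derive_eq (is_deriveX e hF)); rewrite /= jline0.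
Qed.

Lemma dxV F z a : F z != 0 -> dx F z a -> dx (fun w => (F w)^-1) z (- F z ^- 2 * a).
Proof.
move=> Fz hF; have Fz0 : (F \o jline z) 0 != 0 by rewrite /= jline0.
apply: DeriveDef.
  by apply: (@derivableV _ _ (F \o jline z)) => //; case: hF.
rewrite (@deriveV _ _ (F \o jline z)) //; last by case: hF.
by have [_ ->] := hF; rewrite /= jline0.
Qed.

Lemma eq_Dx F G (d D : jet R -> R) z :
  (forall g t0 a, tangent g t0 a -> is_derive t0 1 (d \o g) (a * D (g t0))) ->
  (forall w, d w != 0 -> F w = G w) -> d z != 0 -> Dx F z = Dx G z.
Proof.
move=> dD FG dz; rewrite !DxE; apply: near_eq_derive.
have := tangent_near dD (tangent_jline z); rewrite jline0 => /(_ dz).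
by apply: filterS => t; apply: FG.
Qed.

End DxRules.

Section Generators.
Context {R : realType}.
Implicit Types (z : jet R) (F G : jet R -> R) (g : R -> jet R).
Implicit Types h : 'M[R]_2 * 'cV[R]_2.

Lemma dx_slope h z : dx (slope h) z (h.1 0 1 * jy z 2).
Proof. by have := is_derive_slope h (tangent_jline z); rewrite mul1r jline0. Qed.

Let eq_Dxs h F G z : (forall w, slope h w != 0 -> F w = G w) -> slope h z != 0 -> Dx F z = Dx G z.
Proof. exact: (eq_Dx (D := fun z => h.1 0 1 * jy z 2) (@is_derive_slope _ h)). Qed.

Lemma prolS h l z : prol h l.+1 z = Dx (prol h l) z / slope h z.
Proof. by []. Qed.

Lemma prol1 h z : prol h 1 z = (h.1 1 0 + h.1 1 1 * jy z 1) / slope h z.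
Proof. by rewrite /= Dx_affy. Qed.

Lemma prol2 h z : ASp h -> slope h z != 0 -> prol h 2 z = jy z 2 / slope h z ^+ 3.
Proof.
move=> /symplectic_det dh s0.
rewrite prolS (eq_Dxs (fun w _ => prol1 h w) s0).
rewrite (dxE (dxM (dxD (dx_cst _ _) (dxM (dx_cst _ _) (dx_jy 1 z))) (dxV s0 (dx_slope h z)))) /=.
(* The bracket is the determinant of [h.1]. *)
have e : jy z 2 = jy z 2 * (h.1 1 1 * slope h z - (h.1 1 0 + h.1 1 1 * jy z 1) * h.1 0 1).
  rewrite -[LHS]mulr1 -{1}dh /slope; ring.
rewrite [in RHS]e; field; exact: s0.
Qed.

Lemma prol3 h z : ASp h -> slope h z != 0 ->
  prol h 3 z = (jy z 3 * slope h z - 3 * h.1 0 1 * jy z 2 ^+ 2) / slope h z ^+ 5.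
Proof.
move=> sh s0.
rewrite prolS (eq_Dxs (fun w => @prol2 h w sh) s0).
have s3 : slope h z ^+ 3 != 0 by rewrite expf_neq0.
rewrite (dxE (dxM (dx_jy 2 z) (@dxV _ (fun w => slope h w ^+ 3) _ _ s3 (dxX 3 (dx_slope h z))))) /=.
by field; rewrite s0.
Qed.

Lemma prol4 h z : ASp h -> slope h z != 0 ->
  prol h 4 z = (jy z 4 * slope h z ^+ 2 - 10 * h.1 0 1 * jy z 2 * jy z 3 * slope h z
                + 15 * h.1 0 1 ^+ 2 * jy z 2 ^+ 3) / slope h z ^+ 7.
Proof.
move=> sh s0.
rewrite prolS (eq_Dxs (fun w => @prol3 h w sh) s0).
have s5 : slope h z ^+ 5 != 0 by rewrite expf_neq0.
rewrite (dxE (dxM (dxB (dxM (dx_jy 3 z) (dx_slope h z)) (dxM (dx_cst _ z) (dxX 2 (dx_jy 2 z)))) (@dxV _ (fun w => slope h w ^+ 5) _ _ s5 (dxX 5 (dx_slope h z))))) /=.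
by field; rewrite s0.
Qed.

(** [hessN] over [y_2^(8/3)] is [I4'], which is 9 times the equiaffine curvature. *)
Definition hessN z : R := 3 * jy z 2 * jy z 4 - 5 * jy z 3 ^+ 2.

(** The ratio 3 : 5 is the one for which all terms in [h.1 0 1] coming from [prol3] and [prol4]
    cancel. *)
Lemma hessN_act h z : ASp h -> slope h z != 0 -> hessN (act h z) = hessN z / slope h z ^+ 8.
Proof.
move=> sh s0; rewrite /hessN [jy (act h z) 2]prol2 // [jy (act h z) 3]prol3 // [jy (act h z) 4]prol4 //.
by field; rewrite s0.
Qed.

Lemma cbrtK (a : R) : cbrt a ^+ 3 = a.
Proof.
rewrite /cbrt exprMn -[X in _ * X]powR_mulrn ?powR_ge0 // -powRrM mulVf ?pnatr_eq0 //.
rewrite powRr1 // exprS.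
by have [->|a0] := eqVneq a 0; rewrite ?sgr0 ?mul0r // sqr_sg a0 mulr1 -numEsg.
Qed.

Lemma cbrt_eq0 (a : R) : (cbrt a == 0) = (a == 0).
Proof. by rewrite -{2}(cbrtK a) expf_eq0. Qed.

Lemma cbrt0 : cbrt (0 : R) = 0.
Proof. by apply/eqP; rewrite cbrt_eq0. Qed.

Lemma I4''E z : I4'' z = hessN z ^+ 3 / jy z 2 ^+ 8.
Proof.
rewrite /I4'' /I4' exprMn cbrtK /hessN.
(* At [y_2 = 0] both sides are 0 because [0^-1 = 0], so the cube root disappears at every jet. *)
have [->|y0] := eqVneq (jy z 2) 0; last by field.
by rewrite mul0r expr0n /= invr0 mulr0.
Qed.

Lemma nabla''E F z : nabla'' F z = hessN z / jy z 2 ^+ 3 * Dx F z.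
Proof.
rewrite /nabla'' /nabla' /I4' mulrA; congr (_ * _); rewrite /hessN.
have [->|y0] := eqVneq (jy z 2) 0; first by rewrite cbrt0 invr0 ?expr0n /= ?invr0 ?mulr0 ?mul0r.
have : cbrt (jy z 2) != 0 by rewrite cbrt_eq0.
by move: (cbrt _) => b b0; field; rewrite y0 b0.
Qed.

Notation laurent2 := (laurent coord (fun z : jet R => jy z 2 != 0) (fun z => jy z 2)).

Lemma is_derive_jy2 g t0 a : tangent g t0 a ->
  is_derive t0 1 ((fun z => jy z 2) \o g) (a * jy (g t0) 3).
Proof. by move=> /(_ 3). Qed.

Lemma laurent_jy3 (d : jet R -> R) dom n : (5 <= n)%N -> laurent coord dom d n (fun z => jy z 3).
Proof. exact: (@laurent_var _ _ _ _ _ n 4). Qed.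

Lemma laurent2_Dx n F : (4 <= n)%N -> laurent2 n F -> laurent2 n.+1 (Dx F).
Proof. exact: (laurent_Dx (@laurent_jy3 _ _) is_derive_jy2). Qed.

Lemma laurent2_is_derive n F g t0 a : laurent2 n F -> tangent g t0 a -> jy (g t0) 2 != 0 ->
  is_derive t0 1 (F \o g) (a * Dx F (g t0)).
Proof. exact: (is_derive_tangent (@laurent_jy3 _ _) is_derive_jy2). Qed.

Lemma laurent2_dx n F z : laurent2 n F -> jy z 2 != 0 -> dx F z (Dx F z).
Proof.
move=> lF z0; have := laurent2_is_derive lF (tangent_jline z).
by rewrite jline0 mul1r; apply.
Qed.

Lemma laurent2_jy n l : (l.+1 < n)%N -> laurent2 n (fun z => jy z l).
Proof. exact: laurent_var. Qed.

Lemma laurent2_hessN n : (6 <= n)%N -> laurent2 n hessN.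
Proof.
move=> n6; apply: laurent_sub; apply: laurent_mul.
- by apply: laurent_mul; [exact: laurent_cst|apply: laurent2_jy; apply: leq_trans n6].
- exact: laurent2_jy.
- exact: laurent_cst.
- by apply: laurent_exp; apply: laurent2_jy; apply: leq_trans n6.
Qed.

Lemma laurent2_Vexp n e : laurent2 n (fun z => jy z 2 ^- e).
Proof.
apply: (@laurent_ext _ _ _ _ _ _ (fun z => (jy z 2)^-1 ^+ e)); last by move=> z _; rewrite exprVn.
by apply: laurent_exp; exact: laurent_inv.
Qed.

Lemma laurent2_nabla n F : (6 <= n)%N -> laurent2 n F -> laurent2 n.+1 (nabla'' F).
Proof.
move=> n6 lF; apply: (@laurent_ext _ _ _ _ _ _ (fun z => hessN z / jy z 2 ^+ 3 * Dx F z)).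
  apply: laurent_mul; last by apply: laurent2_Dx => //; apply: leq_trans n6.
  by apply: laurent_mul; [apply: laurent2_hessN; apply: leqW|exact: laurent2_Vexp].
by move=> z _; rewrite nabla''E.
Qed.

Definition nablaI (j : nat) : jet R -> R := iter j nabla'' I4''.

(** [j + 6] counts [x, y_0, ..., y_(j+4)]. *)
Lemma laurent2_nablaI j : laurent2 (j + 6) (nablaI j).
Proof.
elim: j => [|j IH]; last by apply: laurent2_nabla => //; apply: leq_addl.
apply: (@laurent_ext _ _ _ _ _ _ (fun z => hessN z ^+ 3 / jy z 2 ^+ 8)).
  by apply: laurent_mul; [apply: laurent_exp; exact: laurent2_hessN|exact: laurent2_Vexp].
by move=> z _; rewrite /= I4''E.
Qed.

(** The coefficient [N / y_2^3] scales by [m^-8 / m^-9 = m], exactly the factor by which [D_x] is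
    stretched. Asking only for differentiability along curves covers both the iterates and arbitrary
    rational functions. *)
Lemma nabla_act h F G z : ASp h ->
  (forall t0 g a, tangent g t0 a -> g t0 = act h z -> is_derive t0 1 (F \o g) (a * Dx F (g t0))) ->
  (\forall t \near (0 : R), G (jline z t) = F (act h (jline z t))) ->
  slope h z != 0 -> nabla'' G z = nabla'' F (act h z).
Proof.
move=> sh dF GF s0.
have tz : tangent (act h \o jline z) 0 (slope h z).
  by rewrite -[slope h z]mul1r -{2}[z]jline0; apply: tangent_act (tangent_jline z) _; rewrite jline0.
have := dF _ _ _ tz; rewrite /= jline0 => /(_ erefl) [_ dE].
rewrite !nabla''E hessN_act // [jy (act h z) 2]prol2 // DxE.
rewrite (near_eq_derive (g := F \o (act h \o jline z))) // dE.
have [->|y0] := eqVneq (jy z 2) 0.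
  by rewrite mul0r !expr0n /= invr0 !(mulr0, mul0r).
by field; rewrite s0 y0.
Qed.

Lemma jy2_act_neq0 h z : ASp h -> slope h z != 0 -> jy z 2 != 0 -> jy (act h z) 2 != 0.
Proof. by move=> sh s0 y0; rewrite [jy _ _]prol2 // mulf_neq0 // invr_eq0 expf_neq0. Qed.

Lemma nablaI_act h j z : ASp h -> slope h z != 0 -> jy z 2 != 0 -> nablaI j (act h z) = nablaI j z.
Proof.
move=> sh; elim: j z => [|j IH] z s0 y0.
  rewrite /nablaI /= !I4''E hessN_act // [jy (act h z) 2]prol2 //.
  by field; rewrite s0 y0.
rewrite /nablaI !iterS; symmetry; apply: nabla_act => //.
  move=> t0 g a tg gt; apply: (laurent2_is_derive (laurent2_nablaI j) tg).
  by rewrite gt jy2_act_neq0.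
have n1 := slope_near (tangent_jline z); rewrite jline0 in n1.
have n2 := @tangent_near _ _ (fun w => jy w 3) is_derive_jy2 _ _ _ (tangent_jline z); rewrite jline0 in n2.
near=> t; symmetry; apply: IH.
  by near: t; apply: n1.
by near: t; apply: n2.
Unshelve. all: by end_near. Qed.

(** The 9 is [3 * 3], from the cube in [I4''] and from the term [3 y_2 y_4] of [N]. Each further
    step multiplies the lead by [N / y_2^3] and raises its top variable; everything else has lower
    order. *)
Lemma nablaI_lead j : exists2 B, laurent2 (j + 6) B &
  forall z, jy z 2 != 0 ->
    nablaI j.+1 z = 9 * hessN z ^+ (j + 3) / jy z 2 ^+ (3 * j + 10) * jy z (j + 5) + B z.
Proof.
have lA i : laurent2 6 (fun z => 9 * hessN z ^+ (i + 3) / jy z 2 ^+ (3 * i + 10)).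
  apply: laurent_mul; last exact: laurent2_Vexp.
  by apply: laurent_mul; [exact: laurent_cst|apply: laurent_exp; exact: laurent2_hessN].
have lf : laurent2 6 (fun z => hessN z / jy z 2 ^+ 3).
  by apply: laurent_mul; [exact: laurent2_hessN|exact: laurent2_Vexp].
elim: j => [|j [B lB BE]].
  (* What remains of [D_x N = 3 y_2 y_5 - 7 y_3 y_4], together with the derivative of [y_2^-8]. *)
  exists (fun z => - (21 * jy z 2 * jy z 3 * jy z 4 + 8 * hessN z * jy z 3) * hessN z ^+ 3 / jy z 2 ^+ 12).
    apply: laurent_mul; last exact: laurent2_Vexp.
    apply: laurent_mul; last by apply: laurent_exp; exact: laurent2_hessN.
    apply: (@laurent_ext _ _ _ _ _ _ (fun z => 0 - (21 * jy z 2 * jy z 3 * jy z 4 + 8 * hessN z * jy z 3))); last by move=> *; rewrite sub0r.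
    apply: laurent_sub; first exact: laurent_cst.
    apply: laurent_add.
      by do 3?[apply: laurent_mul]; [exact: laurent_cst|exact: laurent2_jy..].
    by do 2?[apply: laurent_mul]; [exact: laurent_cst|exact: laurent2_hessN|exact: laurent2_jy].
  move=> z y0; rewrite /nablaI /= nabla''E.
  have dN : dx hessN z (3 * jy z 2 * jy z 5 - 7 * jy z 3 * jy z 4).
    have -> : @hessN = fun w => 3 * jy w 2 * jy w 4 - 5 * jy w 3 ^+ 2 by [].
    rewrite (_ : 3 * jy z 2 * jy z 5 - _ = 3 * jy z 2 * jy z 5 + jy z 4 * (3 * jy z 3 + jy z 2 * 0)
      - (5 * (2%:R * jy z 3 ^+ 1 * jy z 4) + jy z 3 ^+ 2 * 0)); last by ring.
    exact: (dxB (dxM (dxM (dx_cst 3 z) (dx_jy 2 z)) (dx_jy 4 z)) (dxM (dx_cst 5 z) (dxX 2 (dx_jy 3 z)))).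
  have y8 : jy z 2 ^+ 8 != 0 by rewrite expf_neq0.
  have -> : @I4'' R = fun z => hessN z ^+ 3 / jy z 2 ^+ 8 by apply/funext => w; rewrite I4''E.
  rewrite (dxE (dxM (dxX 3 dN) (@dxV _ (fun w => jy w 2 ^+ 8) _ _ y8 (dxX 8 (dx_jy 2 z))))) /=.
  by field.
pose A z := 9 * hessN z ^+ (j + 3) / jy z 2 ^+ (3 * j + 10).
exists (fun z => hessN z / jy z 2 ^+ 3 * (jy z (j + 5) * Dx A z + Dx B z)).
  apply: laurent_mul; first by apply: laurent_widen lf; rewrite leq_addl.
  apply: laurent_add; last by apply: laurent2_Dx lB; lia.
  apply: laurent_mul; first by apply: laurent2_jy; lia.
  by apply: (@laurent_widen _ _ _ _ _ 7); [lia|apply: laurent2_Dx (lA j)].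
move=> z y0.
have -> : nablaI j.+2 z = nabla'' (nablaI j.+1) z by [].
rewrite nabla''E (eq_Dx (D := fun w => jy w 3) is_derive_jy2 BE y0).
rewrite (dxE (dxD (dxM (laurent2_dx (lA j) y0) (dx_jy (j + 5) z)) (laurent2_dx lB y0))) -/(A _).
rewrite (_ : (3 * j.+1 + 10 = 3 + (3 * j + 10))%N); last by lia.
rewrite (addSn j 5) (addSn j 3) (exprS _ (j + 3)) (exprD _ 3).
move: (Dx A z) (Dx B z) => DA DB; rewrite /A; move: (hessN z ^+ (j + 3)) => H.
have e10 : jy z 2 ^+ (3 * j + 10) != 0 by rewrite expf_neq0.
move: (jy z 2 ^+ (3 * j + 10)) e10 => Q Q0.
by field; rewrite y0 Q0.
Qed.

End Generators.

(** * Polynomial functions and the cross-section *)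

Section PolynomialFunctions.
Context {R : realType}.

(** Points are infinite sequences so that polynomials in different numbers of variables can be
    evaluated at the same point. *)
Definition evals n (P : mpoly n R) (c : nat -> R) : R := meval (fun i : 'I_n => c i) P.

Lemma evals_laurent (T : Type) (c c' : nat -> T -> R) (dom : T -> Prop) d n m (P : mpoly n R) :
  (forall i, (i < n)%N -> laurent c dom d m (c' i)) ->
  laurent c dom d m (fun t => evals P (c' ^~ t)).
Proof. by move=> lc; apply: laurent_meval => i; apply: lc. Qed.

Lemma evals_eq n (P : mpoly n R) (c c' : nat -> R) :
  (forall i, (i < n)%N -> c i = c' i) -> evals P c = evals P c'.
Proof. by move=> cc; apply: meval_eq => i; apply: cc. Qed.

Lemma evals_neq0 n (P : mpoly n R) : P != 0 -> exists c, evals P c != 0.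
Proof.
move=> P0; apply: contrapT => H; case/eqP: P0; apply: meval_eq0 => v.
apply/eqP; apply: contrapT => /negP v0; apply: H.
exists (fun i => oapp v 0 (insub i)); rewrite /evals (meval_eq (v2 := v)) // => i.
by rewrite valK.
Qed.

Lemma neq0_evals n (P : mpoly n R) c : evals P c != 0 -> P != 0.
Proof. by apply: contraNneq => ->; rewrite /evals meval0. Qed.

(** With denominator 1 the closure rules of [laurent] produce polynomials without any handling of
    monomials. *)
Definition polynomial_function n (F : (nat -> R) -> R) : Prop :=
  laurent (fun i (c : nat -> R) => c i) (fun=> True) (fun=> 1) n F.

Lemma polynomial_evals n m (P : mpoly n R) : (n <= m)%N -> polynomial_function m (evals P).
Proof.
move=> nm; apply: (@evals_laurent _ (fun i c => c i) (fun i c => c i)) => i ilt; apply: laurent_var; exact: leq_trans nm.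
Qed.

Lemma polynomial_mpoly n F : polynomial_function n F ->
  exists P : mpoly n R, forall c, evals P c = F c.
Proof.
move=> /(@laurent_normal _ _ _ _ _ _ 1) [||P [e PE]].
- by move=> t _; rewrite meval1.
- by move=> t _; rewrite oner_neq0.
by exists P => c; rewrite PE // expr1n divr1.
Qed.

(** Lets one point avoid the zero sets of two polynomials in different numbers of variables. *)
Lemma evals_mul n m N (P : mpoly n R) (Q : mpoly m R) :
  (n <= N)%N -> (m <= N)%N -> P != 0 -> Q != 0 ->
  exists2 T : mpoly N R, T != 0 & forall c, evals T c = evals P c * evals Q c.
Proof.
move=> nN mN P0 Q0.
have [P' PE] := polynomial_mpoly (polynomial_evals P nN).
have [Q' QE] := polynomial_mpoly (polynomial_evals Q mN).
exists (P' * Q'); last by move=> c; rewrite -PE -QE; exact: mevalM.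
have [c Pc] := evals_neq0 P0; have [c' Qc] := evals_neq0 Q0.
by apply: mulf_neq0; [apply: (@neq0_evals _ _ c)|apply: (@neq0_evals _ _ c')]; rewrite ?PE ?QE.
Qed.

Definition coords (z : jet R) : nat -> R := coord ^~ z.

Definition jet_of (c : nat -> R) := Jet (c 0%N) (fun l => c l.+1).

Lemma coords_jet_of c : coords (jet_of c) = c.
Proof. by apply/funext; case. Qed.

Lemma jet_pol_evals k (p : mpoly k.+2 R) z : jet_pol p z = evals p (coords z).
Proof. by []. Qed.

End PolynomialFunctions.

Section CrossSection.
Context {R : realType}.
Implicit Types (z : jet R) (h g : 'M[R]_2 * 'cV[R]_2).

(* The condition on y_4 makes the coefficient of nabla'' equal to 1; unlike y_2 = 1, it
   is reached without extracting a cube root. *)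
Definition on_section z : Prop :=
  [/\ jx z = 0, jy z 0 = 0, jy z 1 = 0, jy z 3 = 0 & 3 * jy z 4 = jy z 2 ^+ 2]
  /\ jy z 2 != 0.

Lemma hessN_section z : on_section z -> hessN z = jy z 2 ^+ 3.
Proof.
move=> [[_ _ _ e3 e4] _]; rewrite /hessN e3 -mulrA mulrCA e4; ring.
Qed.

Lemma nablaI0_section z : on_section z -> nablaI 0 z = jy z 2.
Proof.
move=> sz; rewrite /nablaI /= I4''E hessN_section //.
by have [_ y0] := sz; field.
Qed.

Lemma nablaI_section j : exists2 B,
  laurent coord (fun z : jet R => jy z 2 != 0) (fun z => jy z 2) (j + 6) B &
  forall z, on_section z -> nablaI j.+1 z = 9 / jy z 2 * jy z (j + 5) + B z.
Proof.
have [B lB BE] := @nablaI_lead R j; exists B => // z sz; have [_ y0] := sz.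
rewrite BE // hessN_section // -exprM; congr (_ * _ + _).
rewrite (_ : 3 * j + 10 = 3 * (j + 3) + 1)%N; last by lia.
rewrite exprD expr1; have : jy z 2 ^+ (3 * (j + 3)) != 0 by rewrite expf_neq0.
by move: (_ ^+ _) => Q Q0; field; rewrite y0 Q0.
Qed.

Definition laurentS := laurent (@nablaI R) on_section (@nablaI R 0).

(** Solves the triangular system for [y_(j+5)], the coordinate of index [j + 6]. The bound [i.+1] is
    not sharp; it is the number of jet coordinates up to [i]. *)
Lemma laurentS_coord i : laurentS i.+1 (coord i).
Proof.
elim/ltn_ind: i => i IH.
have zero F n : (forall z, on_section z -> F z = 0) -> laurentS n F.
  by move=> F0; apply: laurent_ext (laurent_cst _ _ _ _ 0) _ => z /F0 ->.
have y2 n : laurentS n.+1 (fun z => jy z 2).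
  by apply: (@laurent_ext _ _ _ _ _ _ (@nablaI R 0)); [exact: laurent_var|exact: nablaI0_section].
case: i IH => [|[|[|[|[|[|j]]]]]] IH; try by apply: zero => z [[]].
- exact: y2.
- apply: (@laurent_ext _ _ _ _ _ _ (fun z => 3^-1 * (jy z 2 * jy z 2))).
    apply: laurent_mul; first exact: laurent_cst.
    by apply: laurent_mul; exact: y2.
  by move=> z [[_ _ _ _ e4] _]; rewrite -expr2 -e4 mulKf // pnatr_eq0.
have [B lB BE] := nablaI_section j.
apply: (@laurent_ext _ _ _ _ _ _ (fun z => 9^-1 * jy z 2 * (nablaI j.+1 z - B z))).
  apply: laurent_mul; first by apply: laurent_mul; [exact: laurent_cst|exact: y2].
  apply: laurent_sub; first by apply: laurent_var; lia.
  apply: (laurent_comp (s := id) lB) => [z [_ //]|i ilt|].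
    by apply: (@laurent_widen _ _ _ _ _ i.+1); [lia|apply: IH; lia].
  apply: laurent_ext (laurent_inv _ _ _ _) _ => z sz.
  by rewrite nablaI0_section.
move=> z sz; rewrite BE // addrK /= (_ : j + 5 = j.+4.+1)%N; last by lia.
by have [_ y0] := sz; field.
Qed.

(** The iterate of index [n.+1] is affine in [y_(n+5)] with slope [9 / y_2], so this variable can be
    set to reach [c n.+1]; the earlier iterates do not see it. *)
Lemma section_exists (c : nat -> R) n : c 0%N != 0 ->
  exists2 z, on_section z & forall j, (j <= n)%N -> nablaI j z = c j.
Proof.
move=> c0; elim: n => [|n [z sz zc]].
  pose y l := if l == 2%N then c 0%N else if l == 4%N then 3^-1 * c 0%N ^+ 2 else 0.
  have sz : on_section (Jet 0 y).
    by split=> //; split=> //=; rewrite mulVKf // pnatr_eq0.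
  by exists (Jet 0 y) => // j; rewrite leqn0 => /eqP ->; rewrite nablaI0_section.
have [B lB BE] := nablaI_section n.
pose w := Jet (jx z) (fun l => if l == (n + 5)%N then c 0%N / 9 * (c n.+1 - B z) else jy z l).
have wE l : (l < n + 5)%N -> jy w l = jy z l by rewrite /w /= => /ltn_eqF ->.
have [_ y0] := sz.
have w2 : jy w 2 = jy z 2 by rewrite wE //; lia.
have sw : on_section w.
  have [[? ? ? ? ?] _] := sz; split; rewrite ?w2 //.
  by split=> //; rewrite ?w2 wE //; lia.
have loc m F : (m <= n + 6)%N ->
    laurent coord (fun z : jet R => jy z 2 != 0) (fun z => jy z 2) m F -> F w = F z.
  move=> mn lF; apply: (laurent_local lF); rewrite ?w2 // => -[|i] // ilt.
  by apply: wE; lia.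
exists w => // j; rewrite leq_eqVlt => /predU1P [->|jn].
  have z0 : jy z 2 = c 0%N by rewrite -nablaI0_section // zc.
  rewrite BE // (loc _ _ _ lB) // w2 z0 /w /= eqxx.
  by field.
by rewrite (loc _ _ _ (laurent2_nablaI j)) ?zc //; lia.
Qed.

(* The slope m is forced by the condition on y_4, the entry b by y_3 = 0, and the rest by
   y_1 = 0 and det = 1. *)
Lemma normalize z : jy z 2 != 0 -> hessN z != 0 ->
  exists h, [/\ ASp h, slope h z != 0 & on_section (act h z)].
Proof.
move=> y0 N0.
(* Once [y_3 = 0], the condition on [y_4] says [N = y_2^3], that is [N / m^8 = (y_2 / m^3)^3] before
   the move. *)
pose m := jy z 2 ^+ 3 / hessN z.
have m0 : m != 0 by rewrite mulf_neq0 ?expf_neq0 // invr_eq0.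
pose b := jy z 3 * m / (3 * jy z 2 ^+ 2); pose a := m - b * jy z 1.
pose c := - jy z 1 / m; pose d := m^-1.
pose A : 'M[R]_2 := \matrix_(i, j) if i == 0 then (if j == 0 then a else b) else (if j == 0 then c else d).
pose v : 'cV[R]_2 := \col_i if i == 0 then - (a * jx z + b * jy z 0) else - (c * jx z + d * jy z 0).
have sm : slope (A, v) z = m by rewrite /slope /= !mxE /= /a subrK.
have sA : ASp (A, v).
  by apply/symplectic_det; rewrite /= !mxE /= /a /c /d; field.
exists (A, v); split; rewrite ?sm //; split; last by apply: jy2_act_neq0; rewrite ?sm.
split.
- by rewrite /= /affx /= !mxE /= addrN.
- by rewrite /= /affy /= !mxE /= addrN.
- by rewrite [LHS]prol1 sm /= !mxE /= /c /d; field.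
- rewrite [LHS]prol3 ?sm // /= !mxE /= /b; field.
  by rewrite m0 y0.
- rewrite [jy (act _ z) 4]prol4 ?sm // [jy (act _ z) 2]prol2 ?sm // /= !mxE /= /b.
  have N0' := N0; rewrite /m; rewrite /hessN in N0' *.
  by field; rewrite y0 N0'.
Qed.

(** Folds all genericity conditions into one polynomial of the shape that [geneq] asks for. *)
Lemma generic_mpoly n (s : mpoly n R) : s != 0 ->
  exists (k : nat) (T : mpoly k.+2 R), T != 0 /\
    forall z, jet_pol T z = evals s (coords z) * (jy z 2 * hessN z).
Proof.
move=> s0.
have pN : polynomial_function 6 (fun c : nat -> R => c 3%N * (3 * c 3%N * c 5%N - 5 * c 4%N ^+ 2)).
  have v i : (i < 6)%N -> polynomial_function 6 (fun c : nat -> R => c i).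
    by move=> ilt; exact: (@laurent_var _ _ (fun i (c : nat -> R) => c i)).
  apply: laurent_mul; first exact: v.
  apply: laurent_sub; apply: laurent_mul; try exact: laurent_cst.
  - by apply: laurent_mul; [exact: laurent_cst|exact: v].
  - exact: v.
  - by apply: laurent_exp; exact: v.
have [P PE] := polynomial_mpoly pN.
have P0 : P != 0.
  apply: (@neq0_evals _ _ _ (fun i => if i == 4%N then 0 else 1)); rewrite PE /=.
  by rewrite expr0n /= mulr0 subr0 !mulr1 mul1r pnatr_eq0.
have n4 : (n <= (n + 4).+2)%N by lia.
have n6 : (6 <= (n + 4).+2)%N by lia.
have [T T0 TE] := evals_mul n4 n6 s0 P0.
by exists (n + 4)%N, T; split=> // z; rewrite jet_pol_evals TE PE.
Qed.

Lemma generic_jet n (s : mpoly n R) : s != 0 ->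
  exists z, [/\ evals s (coords z) != 0, jy z 2 != 0 & hessN z != 0].
Proof.
move=> /generic_mpoly [k [T [T0 TE]]]; have [c] := evals_neq0 T0.
rewrite -(coords_jet_of c) -jet_pol_evals TE !mulf_eq0 !negb_or => /and3P[sc c3 Nc].
by exists (jet_of c).
Qed.

(* A section point, moved by a fixed g, sweeps out a translate of the cross-section
   that passes through any prescribed generic jet. *)
Lemma through_jet z : jy z 2 != 0 -> hessN z != 0 ->
  exists g n, [/\ ASp g, g.1 0 0 != 0, on_section n & act g n = z].
Proof.
move=> y0 N0; have [h [sh h0 sec]] := normalize y0 N0.
have [g sg gh] := ASp_inv sh; exists g, (act h z).
have e : slope g (act h z) * slope h z = 1.
  by rewrite -slope_hcomp // gh /slope /= !mxE /= mul0r addr0.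
have g0 : slope g (act h z) != 0.
  by apply: contra_eq_neq e => ->; rewrite mul0r eq_sym oner_neq0.
split=> //; last by rewrite -act_hcomp // gh act1.
move: g0; rewrite /slope; case: sec => -[_ _ -> _ _] _.
by rewrite mulr0 addr0.
Qed.

Lemma slope_section g z : on_section z -> slope g z = g.1 0 0.
Proof. by move=> [[_ _ e _ _] _]; rewrite /slope e mulr0 addr0. Qed.

(** As [y_1 = 0] on the section, the slope of [g] is the constant [g.1 0 0]; the only denominator
    left is [y_2], which is [nablaI 0]. *)
Lemma jet_pol_section g k (p : mpoly k.+2 R) : g.1 0 0 != 0 ->
  exists (P : mpoly k.+3 R) (e : nat), forall z, on_section z ->
    jet_pol p (act g z) = evals P (nablaI ^~ z) / nablaI 0 z ^+ e.
Proof.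
move=> g0.
have lc i : (i < k.+2)%N -> laurentS k.+3 (fun z => coord i (act g z)).
  have lcomp n F : (n <= k.+3)%N -> laurent coord (fun z => slope g z != 0) (slope g) n F ->
      laurentS k.+3 F.
    move=> nk lF; apply: (laurent_comp (s := id) lF) => [z /slope_section -> //|j jn|].
      by apply: laurent_widen (laurentS_coord j); lia.
    apply: laurent_ext (laurent_cst _ _ _ _ (g.1 0 0)^-1) _ => z sz.
    by rewrite /= slope_section.
  case: i => [|l] lk; last by apply: lcomp (laurent_prol g l); lia.
  apply: (@lcomp 2) => //.
  apply: (@laurent_add _ _ _ _ _ _ (fun z => _ * jx z + _ * jy z 0) (fun=> g.2 0 0)); last exact: laurent_cst.
  apply: laurent_add; apply: laurent_mul; try exact: laurent_cst.
    exact: (@laurent_var _ _ _ _ _ _ 0).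
  exact: (@laurent_var _ _ _ _ _ _ 1).
have := @evals_laurent _ _ _ (fun i z => coord i (act g z)) _ _ _ _ p lc.
move=> /(@laurent_normal _ _ _ _ _ _ (mpolyX R (mnm1 0))) [||P [e PE]].
- by move=> z _; rewrite mevalXU.
- by move=> z sz; rewrite nablaI0_section //; case: sz.
by exists P, e => z sz; rewrite -PE.
Qed.

End CrossSection.

(** * Independence and generation *)

Section Main.
Context {R : realType}.
Implicit Types (z : jet R) (h g : 'M[R]_2 * 'cV[R]_2).

Lemma nablaI0_neq0_section z : on_section z -> nablaI 0 z != 0.
Proof. by move=> sz; rewrite nablaI0_section //; case: sz. Qed.

Lemma nablaI_act_section g z j : ASp g -> g.1 0 0 != 0 -> on_section z ->
  nablaI j (act g z) = nablaI j z.
Proof.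
by move=> sg g0 sz; apply: nablaI_act => //; [rewrite slope_section|case: sz].
Qed.

(** If [P] is nonzero, values [c] exist at which [P], the restriction [S] of [s] to the translate,
    and [c 0] are all nonzero. A section point with these values, moved by [g], lies off the zeros
    of [s] and contradicts the relation. *)
Lemma nablaI_independent n (P : mpoly n R) :
  geneq (eval_orbit I4'' nabla'' P) (fun=> 0) -> P = 0.
Proof.
move=> [k [s [s0 sP]]]; apply/eqP; apply: contrapT => /negP P0.
have [z0 [sz0 y0 N0]] := generic_jet s0; rewrite -jet_pol_evals in sz0.
have [g [n0 [sg g0 secn0 gn0]]] := through_jet y0 N0.
have [S [e SE]] := jet_pol_section s g0.
have S0 : S != 0.
  apply: (@neq0_evals _ _ _ (nablaI ^~ n0)); move: sz0; rewrite -gn0 SE //.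
  by rewrite mulf_eq0 negb_or => /andP[].
pose N := maxn n k.+3.
have [T T0 TE] := evals_mul (leq_maxl n k.+3) (leq_maxr n k.+3) P0 S0.
have X0 : mpolyX R (mnm1 (0 : 'I_k.+3)) != 0.
  by apply: (@neq0_evals _ _ _ (fun=> 1)); rewrite /evals mevalXU oner_neq0.
have [U U0 UE] := evals_mul (leqnn N) (leq_maxr n k.+3) T0 X0.
have [c] := evals_neq0 U0; rewrite UE TE {3}/evals mevalXU !mulf_eq0 !negb_or.
move=> /andP[/andP[Pc Sc] c0].
have [z sz zc] := section_exists N c0.
have Ez m : (m <= N)%N -> forall Q : mpoly m R, evals Q (nablaI ^~ z) = evals Q c.
  by move=> mN Q; apply: evals_eq => i im; apply: zc; apply: leq_trans mN; apply: ltnW.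
have := sP (act g z); rewrite SE // (Ez _ (leq_maxr _ _)) mulf_neq0 //; last first.
  by rewrite invr_eq0 expf_neq0 // nablaI0_neq0_section.
move=> /(_ isT); apply/eqP.
rewrite -[eval_orbit _ _ _ _]/(evals P (nablaI ^~ (act g z))).
suff -> : evals P (nablaI ^~ (act g z)) = evals P (nablaI ^~ z) by rewrite Ez ?leq_maxl.
by apply: evals_eq => i _; apply: nablaI_act_section.
Qed.

Lemma A_H_generated F : A_H F -> exists (n : nat) (P Q : mpoly n R),
  ~ geneq (eval_orbit I4'' nabla'' Q) (fun=> 0) /\
  geneq F (fun z => eval_orbit I4'' nabla'' P z / eval_orbit I4'' nabla'' Q z).
Proof.
move=> [k [p [q [q0 Fpq Finv]]]].
have [z0 [qz0 y0 N0]] := generic_jet q0; rewrite -jet_pol_evals in qz0.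
have [g [n0 [sg g0 secn0 gn0]]] := through_jet y0 N0.
have [P1 [e1 PE]] := jet_pol_section p g0.
have [Q1 [e2 QE]] := jet_pol_section q g0.
pose X : mpoly k.+3 R := mpolyX R (mnm1 0).
have XE c : evals X c = c 0%N by rewrite /evals mevalXU.
have PXE e (T : mpoly k.+3 R) c : evals (T * X ^+ e) c = evals T c * c 0%N ^+ e.
  by rewrite /evals mevalM rmorphXn /= -XE.
have Q1n0 : evals Q1 (nablaI ^~ n0) != 0.
  by move: qz0; rewrite -gn0 QE // mulf_eq0 negb_or => /andP[].
(* The quotient of [P1 / X ^+ e1] by [Q1 / X ^+ e2], cleared of inner denominators. *)
exists k.+3, (P1 * X ^+ e2), (Q1 * X ^+ e1); split.
  move/nablaI_independent => Q0; have := PXE e1 Q1 (nablaI ^~ n0).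
  rewrite Q0 [LHS]meval0 => /esym/eqP; rewrite mulf_eq0 (negPf Q1n0) /=.
  by rewrite expf_eq0 (negPf (nablaI0_neq0_section secn0)) andbF.
(* Exceptional sets are zero sets of jet polynomials, so [Q1] of the iterates is rewritten as [S]
   over a power of [y_2]. *)
have lQ : laurent coord (fun z : jet R => jy z 2 != 0) (fun z => jy z 2) (k + 9)
    (fun z => evals Q1 (nablaI ^~ z)).
  apply: (@evals_laurent _ _ coord (@nablaI R) _ _ _ _ Q1) => i ilt.
  by apply: laurent_widen (laurent2_nablaI i); lia.
have [S [e SE]] : exists (S : mpoly (k + 9) R) e, forall z, jy z 2 != 0 ->
    evals Q1 (nablaI ^~ z) = evals S (coords z) / jy z 2 ^+ e.
  have i3 : (3 < k + 9)%N by lia.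
  apply: (@laurent_normal _ _ _ _ _ _ (mpolyX R (mnm1 (Ordinal i3))) _ _ _ lQ) => // z _.
  by rewrite mevalXU.
have S0 : S != 0.
  apply: (@neq0_evals _ _ _ (coords z0)).
  have : evals Q1 (nablaI ^~ z0) != 0.
    rewrite -gn0 (_ : nablaI ^~ (act g n0) = nablaI ^~ n0) //.
    by apply/funext => j; apply: nablaI_act_section.
  by rewrite SE // mulf_eq0 negb_or => /andP[].
have [T T0 TE] := evals_mul (leq_maxl k.+2 (k + 9)) (leq_maxr k.+2 (k + 9)) q0 S0.
have [K [V [V0 VE]]] := generic_mpoly T0.
exists K, V; split=> // z; rewrite VE TE !mulf_eq0 !negb_or.
move=> /andP[/andP[qz Sz] /andP[yz Nz]].
have Q1z : evals Q1 (nablaI ^~ z) != 0.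
  by rewrite SE // mulf_eq0 negb_or Sz invr_eq0 expf_neq0.
(* [h] carries [z] to the section and [g] on to the translate. There [q] is nonzero because [Q1] has
   the same value as at [z], so invariance allows [F] to be computed there. *)
have [h [sh h0 sec]] := normalize yz Nz.
have g1 : slope g (act h z) != 0 by rewrite slope_section.
have invE : nablaI ^~ (act h z) = nablaI ^~ z.
  by apply/funext => j; apply: nablaI_act.
have i0 : nablaI 0 z != 0 by rewrite -(nablaI_act 0 sh h0 yz) nablaI0_neq0_section.
have pz : prolongs k (hcomp g h) z (act g (act h z)).
  by rewrite -act_hcomp //; apply: prolongs_act; rewrite slope_hcomp // mulf_neq0.
have qz' : jet_pol q (act g (act h z)) != 0.
  by rewrite QE // invE (congr1 (fun c => c 0%N) invE) mulf_neq0 // invr_eq0 expf_neq0.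
rewrite -(Finv _ _ _ (ASp_hcomp sg sh) pz qz qz') Fpq // /jet_rat.
rewrite PE // QE // invE (congr1 (fun c => c 0%N) invE).
rewrite -[eval_orbit _ _ (P1 * _) z]/(evals (P1 * X ^+ e2) (nablaI ^~ z)).
rewrite -[eval_orbit _ _ (Q1 * _) z]/(evals (Q1 * X ^+ e1) (nablaI ^~ z)) !PXE.
have i1 : nablaI 0 z ^+ e1 != 0 by rewrite expf_neq0.
have i2 : nablaI 0 z ^+ e2 != 0 by rewrite expf_neq0.
move: (nablaI 0 z ^+ e1) (nablaI 0 z ^+ e2) i1 i2 => a b a0 b0.
by field; rewrite Q1z a0 b0.
Qed.

Lemma generated_A_H F n (P Q : mpoly n R) :
  ~ geneq (eval_orbit I4'' nabla'' Q) (fun=> 0) ->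
  geneq F (fun z => eval_orbit I4'' nabla'' P z / eval_orbit I4'' nabla'' Q z) ->
  A_H F.
Proof.
move=> Q0 [k [s [s0 sE]]].
have i3 : (3 < n + 6)%N by lia.
have ex (T : mpoly n R) : exists (S : mpoly (n + 6) R) e, forall z, jy z 2 != 0 ->
    evals T (nablaI ^~ z) = evals S (coords z) / jy z 2 ^+ e.
  apply: (@laurent_normal _ _ _ _ _ _ (mpolyX R (mnm1 (Ordinal i3)))) => //.
    by move=> z _; rewrite mevalXU.
  apply: (@evals_laurent _ _ coord (@nablaI R) _ _ _ _ T) => i ilt.
  by apply: laurent_widen (laurent2_nablaI i); lia.
have [S1 [e1 PE]] := ex P; have [S2 [e2 QE]] := ex Q.
pose K := (n + k + 4)%N.
have K3 : (3 < K.+2)%N by rewrite /K; lia.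
have [Y YE] := polynomial_mpoly (laurent_var (fun i (c : nat -> R) => c i) (fun=> True) (fun=> 1) K3).
have Y0 : Y != 0 by apply: (@neq0_evals _ _ _ (fun=> 1)); rewrite YE oner_neq0.
have S20 : S2 != 0.
  apply/eqP => S20; apply: Q0; exists K, Y; split=> // z; rewrite jet_pol_evals YE => y0.
  by have := QE z y0; rewrite S20 [evals 0 _]meval0 mul0r.
have nK : (n + 6 <= K.+2)%N by rewrite /K; lia.
have kK : (k.+2 <= K.+2)%N by rewrite /K; lia.
have [s' s'E] := polynomial_mpoly (polynomial_evals s kK).
have [S1' S1E] := polynomial_mpoly (polynomial_evals S1 nK).
have [S2' S2E] := polynomial_mpoly (polynomial_evals S2 nK).
(* The factor [s'] makes [p / q] equal to [F] wherever [q] is nonzero, and the extra power of [Y]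
   makes [q != 0] imply [y_2 != 0] even when [e1 = 0]. *)
pose p := s' * S1' * Y ^+ e2.+1; pose q := s' * S2' * Y ^+ e1.+1.
have prodE (A B : mpoly K.+2 R) e z : jet_pol (A * B * Y ^+ e) z =
    jet_pol A z * jet_pol B z * jy z 2 ^+ e.
  by rewrite /jet_pol !mevalM rmorphXn /= -/(jet_pol Y z) jet_pol_evals YE.
have qE z : jet_pol q z != 0 ->
    [/\ jet_pol s z != 0, jy z 2 != 0, evals Q (nablaI ^~ z) != 0 &
      jet_rat p q z = evals P (nablaI ^~ z) / evals Q (nablaI ^~ z)].
  rewrite /jet_rat !prodE !jet_pol_evals s'E S1E S2E !mulf_eq0 !negb_or.
  move=> /andP[/andP[sz S2z]]; rewrite expf_eq0 /= => yz.
  have a0 : jy z 2 ^+ e1 != 0 by rewrite expf_neq0.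
  have b0 : jy z 2 ^+ e2 != 0 by rewrite expf_neq0.
  split=> //; first by rewrite QE // mulf_neq0 // invr_eq0.
  rewrite PE // QE // !exprS; move: (_ ^+ e1) (_ ^+ e2) a0 b0 => a b a0 b0.
  by field; rewrite sz S2z yz a0 b0.
exists K, p, q; split.
- apply: mulf_neq0; last by rewrite expf_neq0.
  have [c sc] := evals_neq0 s0; have [c' Sc'] := evals_neq0 S20.
  by apply: mulf_neq0; [apply: (@neq0_evals _ _ _ c); rewrite s'E|apply: (@neq0_evals _ _ _ c'); rewrite S2E].
- by move=> z /qE [sz _ _ ->]; rewrite sE.
move=> h z z' sh pzz' qz qz'.
have K0 : (0 < K)%N by rewrite /K addnS.
have h0 := prolongs_slope K0 sh pzz'.
have [xz' yz'] := proj1 (prolongsP z' K0 h0) pzz'.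
(* [prolongs K] fixes only the coordinates up to [y_K], the only ones that [T] sees. *)
have E (T : mpoly K.+2 R) : jet_pol T z' = jet_pol T (act h z).
  by rewrite !jet_pol_evals; apply: evals_eq => -[|i] // ilt; apply: yz'.
have FE w : jet_pol q w != 0 -> F w = jet_rat p q w.
  by move=> /qE [sw _ _ ->]; rewrite sE.
rewrite !FE // {1}/jet_rat !E -/(jet_rat p q (act h z)).
have [_ yz _ ->] := qE z qz; have [_ _ _ ->] := qE (act h z) (etrans (congr1 (fun a => a != 0) (esym (E q))) qz').
have -> // : nablaI ^~ (act h z) = nablaI ^~ z.
by apply/funext => j; apply: nablaI_act.
Qed.

(** * Rational functions along curves and the invariance of the derivation *)

Lemma laurent_jet_pol (d : jet R -> R) dom k (p : mpoly k.+2 R) : laurent coord dom d k.+2 (jet_pol p).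
Proof. by apply: (@evals_laurent _ _ coord coord _ _ _ _ p) => i; apply: laurent_var. Qed.

Lemma is_derive_jet_pol k (q : mpoly k.+2 R) (g : R -> jet R) t0 a : tangent g t0 a ->
  is_derive t0 1 (jet_pol q \o g) (a * Dx (jet_pol q) (g t0)).
Proof.
move=> tg.
apply: (@is_derive_tangent _ (fun=> 1) (fun=> 0) 0 _ _ k.+2 _ _ _ _ _ tg).
- by move=> *; apply: laurent_cst.
- by move=> *; rewrite mulr0; apply: is_derive_cst.
- exact: laurent_jet_pol.
- exact: oner_neq0.
Qed.

Lemma laurent_Dx_jet_pol (d : jet R -> R) dom k (q : mpoly k.+2 R) n : (k.+3 <= n)%N ->
  laurent coord dom d n (Dx (jet_pol q)).
Proof.
move=> kn.
have l1 : laurent coord (fun z => (1 : R) != 0) (fun=> 1) k.+3 (Dx (jet_pol q)).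
  apply: (@laurent_Dx _ (fun=> 1) (fun=> 0) 0) => //.
  - by move=> *; apply: laurent_cst.
  - by move=> *; rewrite mulr0; apply: is_derive_cst.
  - exact: laurent_jet_pol.
apply: (laurent_comp (s := id) l1) => [z _|i ilt|]; first exact: oner_neq0.
  by apply: laurent_var; apply: leq_trans kn.
exact: laurent_cst.
Qed.

Lemma is_derive_jet_rat k (p q : mpoly k.+2 R) (g : R -> jet R) t0 a : tangent g t0 a -> jet_pol q (g t0) != 0 ->
  is_derive t0 1 (jet_rat p q \o g) (a * Dx (jet_rat p q) (g t0)).
Proof.
move=> tg q0.
apply: (@is_derive_tangent _ (jet_pol q) (Dx (jet_pol q)) k.+3 _ _ k.+2 _ _ _ _ _ tg) => //.
- by move=> n kn; apply: laurent_Dx_jet_pol.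
- exact: is_derive_jet_pol.
by apply: laurent_mul; [exact: laurent_jet_pol|exact: laurent_inv].
Qed.

Lemma nabla''_invariant : invariant_derivation (@nabla'' R).
Proof.
(* The exceptional polynomial can be 1: with [0^-1 = 0] the coefficient obeys its transformation law
   at [y_2 = 0] as well. *)
exists (fun z => hessN z / jy z 2 ^+ 3), 4%N, (1 : mpoly 6 R); split.
- exact: oner_neq0.
- by move=> z w _ zw; rewrite /hessN !zw.
- by move=> F z; rewrite nabla''E.
move=> h m p q G sh GF z z' /(prolongs_infP _ _ sh) [h0 ->] _ _ qz.
apply: nabla_act => //.
  by move=> t0 g a tg gt; apply: is_derive_jet_rat; rewrite ?gt.
have := @slope_near _ h _ _ _ (tangent_jline z); rewrite jline0 => /(_ h0).
by apply: filterS => t ht; apply: GF; apply/(prolongs_infP _ _ sh).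
Qed.

End Main.

Theorem mainTheorem12 (R : realType) :
  [/\ @A_H R I4'',
      @invariant_derivation R nabla'' &
      @freely_generated R A_H I4'' nabla''].
Proof.
split; last split; [|exact: nabla''_invariant| |exact: nablaI_independent].
  apply: (@generated_A_H _ _ 1 (mpolyX R (mnm1 0)) 1).
    by move=> /nablaI_independent /eqP; rewrite oner_eq0.
  exists 0%N, 1; split=> [|z _]; first exact: oner_neq0.
  by rewrite /eval_orbit mevalXU meval1 divr1.
move=> F; split=> [|[n [P [Q [Q0 FE]]]]]; first exact: A_H_generated.
exact: generated_A_H Q0 FE.
Qed.
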